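(* Let $d\in\mathbb N$ and $\varepsilon>0$, put $\delta_1=2\big(\sqrt{2\varepsilon}+7\varepsilon+2\sqrt2\,\varepsilon^{3/2}+3\varepsilon^2\big)$ and $\delta_2=2\varepsilon+\varepsilon^2$, and assume $8\delta_1+\delta_2<\frac12$. For any $\varepsilon$-universal programmable quantum processor $G\in\mathrm U(\mathcal H_D\otimes\mathcal H_P)$ with $|D|=d$, the program register has dimension at least $$ |P|\ \ge\ \frac{1}{2(4\delta_1+\delta_2)^2}\,\min\left(1,\ \left(\Big(\frac{\pi d}{e}\Big)^d(4\delta_1+\delta_2)^2\right)^{\frac{2}{d^2+1}}\right). $$ Furthermore, there exists a universal constant $\eta>0$ (independent of $d,\varepsilon,G$) such that whenever $$ 8\delta_1+\delta_2>\left[\Big(\frac{\pi d}{e}\Big)^{-d}2^{-d^2+1}\right]^{\eta}, $$ the alternative bound $$ |P|\ \ge\ \eta\,\frac{d\log\big(\frac{\pi d}{e}\big)+d^2-1}{2\delta_4^2\log\frac1{\delta_4}},\qquad \delta_4:=8\delta_1+\delta_2, $$ holds.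
   Context: $\log$ is base 2; $|X|=\dim\mathcal H_X$; Hilbert spaces are finite-dimensional. The diamond norm of a linear map $\Lambda:\mathrm{End}(\mathcal H_A)\to\mathrm{End}(\mathcal H_B)$ is $\|\Lambda\|_\diamond=\sup_{\rho_{AE}}\|(\Lambda\otimes\mathrm{id}_E)(\rho_{AE})\|_1$, the supremum over all auxiliary systems $E$ and quantum states $\rho_{AE}$. A unitary $G\in\mathrm U(\mathcal H_D\otimes\mathcal H_P)$ is an $\varepsilon$-universal programmable quantum processor if for each $U\in\mathrm U(\mathcal H_D)$ there is a unit vector $|U\rangle_P\in\mathcal H_P$ such that $$\big\|\mathrm{tr}_P\,G\big((\cdot)_D\otimes|U\rangle\langle U|_P\big)G^\dagger-U(\cdot)_DU^\dagger\big\|_\diamond\le\varepsilon.$$ $D$ is the data register and $P$ the program register. *)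

(* Defs.v *)
From HB Require Import structures.
From mathcomp Require Import all_boot all_order all_algebra.
From mathcomp Require Import spectral mxtens complex.
From mathcomp Require Import all_classical all_reals all_analysis.

Set Implicit Arguments.
Unset Strict Implicit.
Unset Printing Implicit Defensive.

Import Order.TTheory GRing.Theory Num.Theory.
Import numFieldNormedType.Exports.

Local Open Scope classical_set_scope.
Local Open Scope ring_scope.
Local Open Scope sesquilinear_scope.
Local Open Scope complex_scope.

(* A Hilbert space of dimension n is C^n with C = R[i]; End(C^n) is 'M[R[i]]_n.
   The tensor product C^m (x) C^n is C^(m * n), with the Kronecker product
   [tensmx] and the index pairing [mxtens_index] of mxtens. *)

Section QuantumMaps.
Variable R : realType.
Local Notation C := R[i].

Definition psdmx (n : nat) (A : 'M[C]_n) : Prop :=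
  forall v : 'cV[C]_n, 0 <= (v^t* *m A *m v) ord0 ord0.

Definition quantum_state (n : nat) (rho : 'M[C]_n) : Prop :=
  psdmx rho /\ \tr rho = 1.

(* tr sqrt(A^* A): the sum of the square roots of the eigenvalues of A^* A,
   which are real and nonnegative. *)
Definition trace_norm (n : nat) (A : 'M[C]_n) : R :=
  \sum_(i < n) Num.sqrt (complex.Re (spectral_diag (A^t* *m A) ord0 i)).

(* The (k, l) block <k|_E X |l>_E of an operator X on A (x) E. *)
Definition aux_block (a e : nat) (X : 'M[C]_(a * e)) (k l : 'I_e) : 'M[C]_a :=
  \matrix_(i, j) X (mxtens_index (i, k)) (mxtens_index (j, l)).

(* f (x) id_E applies f to every block: X = \sum_(k, l) X_kl (x) |k><l| is sent
   to \sum_(k, l) f(X_kl) (x) |k><l|. *)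
Definition tens_id (a b e : nat) (f : {linear 'M[C]_a -> 'M[C]_b})
    (X : 'M[C]_(a * e)) : 'M[C]_(b * e) :=
  \sum_(k < e) \sum_(l < e) tensmx (f (aux_block X k l)) (delta_mx k l).

Lemma tens_id_tensmx (a b e : nat) (f : {linear 'M[C]_a -> 'M[C]_b})
    (A : 'M[C]_a) (B : 'M[C]_e) :
  tens_id f (tensmx A B) = tensmx (f A) B.
Proof.
rewrite /tens_id {2}[B]matrix_sum_delta.
apply/matrixP => i j; rewrite summxE [RHS]mxE summxE mulr_sumr.
apply: eq_bigr => k _; rewrite !summxE mulr_sumr; apply: eq_bigr => l _.
have -> : aux_block (tensmx A B) k l = B k l *: A.
  by apply/matrixP => x y; rewrite !mxE !mxtens_indexK mulrC.
by rewrite linearZ !mxE mulrCA mulrA.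
Qed.

Definition diamond_norm (a b : nat) (f : {linear 'M[C]_a -> 'M[C]_b}) : \bar R :=
  ereal_sup [set x | exists (e : nat) (rho : 'M[C]_(a * e)),
    quantum_state rho /\ x = (trace_norm (tens_id f rho))%:E].

Definition ptrace_r (d p : nat) (X : 'M[C]_(d * p)) : 'M[C]_d :=
  \sum_(k < p) aux_block X k k.

Definition unit_vector (p : nat) (psi : 'cV[C]_p) : Prop := psi^t* *m psi = 1%:M.

Definition programmed_map (d p : nat) (G : 'M[C]_(d * p)) (psi : 'cV[C]_p)
    (X : 'M[C]_d) : 'M[C]_d :=
  ptrace_r (G *m tensmx X (psi *m psi^t*) *m G^t*).

Fact programmed_map_is_linear (d p : nat) (G : 'M[C]_(d * p)) (psi : 'cV[C]_p) :
  linear (programmed_map G psi).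
Proof.
move=> c X Y; rewrite /programmed_map /ptrace_r.
have -> : tensmx (c *: X + Y) (psi *m psi^t*) =
    c *: tensmx X (psi *m psi^t*) + tensmx Y (psi *m psi^t*).
  by apply/matrixP => i j; rewrite !mxE mulrDl mulrA.
rewrite mulmxDr mulmxDl -scalemxAr -scalemxAl scaler_sumr -big_split /=.
by apply: eq_bigr => k _; apply/matrixP => i j; rewrite !mxE.
Qed.

HB.instance Definition _ (d p : nat) (G : 'M[C]_(d * p)) (psi : 'cV[C]_p) :=
  GRing.isLinear.Build C 'M[C]_d 'M[C]_d _ (programmed_map G psi)
    (programmed_map_is_linear G psi).

Definition unitary_map (d : nat) (U X : 'M[C]_d) : 'M[C]_d := U *m X *m U^t*.

Fact unitary_map_is_linear (d : nat) (U : 'M[C]_d) : linear (unitary_map U).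
Proof.
by move=> c X Y; rewrite /unitary_map mulmxDr mulmxDl -scalemxAr -scalemxAl.
Qed.

HB.instance Definition _ (d : nat) (U : 'M[C]_d) :=
  GRing.isLinear.Build C 'M[C]_d 'M[C]_d _ (unitary_map U)
    (unitary_map_is_linear U).

Definition universal_processor (d p : nat) (eps : R) (G : 'M[C]_(d * p)) : Prop :=
  G \is unitarymx /\
  forall U : 'M[C]_d, U \is unitarymx ->
    exists psi : 'cV[C]_p, unit_vector psi /\
      (@diamond_norm d d (programmed_map G psi \- unitary_map U)%R <= eps%:E)%E.

End QuantumMaps.

Section Bounds.
Variable R : realType.
Implicit Types eps x : R.

Definition log2 x : R := ln x / ln 2.

Definition delta1 eps : R :=
  2 * (Num.sqrt (2 * eps) + 7 * eps + 2 * Num.sqrt 2 * eps `^ (3 / 2)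
       + 3 * eps ^+ 2).

Definition delta2 eps : R := 2 * eps + eps ^+ 2.

Definition delta4 eps : R := 8 * delta1 eps + delta2 eps.

Definition pide (d : nat) : R := pi * d%:R / expR 1.

End Bounds.

Arguments pide : clear implicits.

(* Main.v *)
(** Let G be a processor with program vectors psi_U, so that G(phi (x) psi_U) is
    close to U phi (x) u_U for a residual program vector u_U of norm close to 1.
    As phi |-> G(phi (x) psi_U) has Gram matrix <psi_U, psi_V> 1 while
    phi |-> U phi (x) u_U has Gram matrix <u_U, u_V> U^* V, testing against a
    traceless operator forces |<u_U, u_V>|^2 = O(eps) / (1 - w^2), where w is the
    normalized trace of U^* V.  On the other hand the maps
    phi |-> G(phi (x) psi_U) lie in a space of dimension |P|, and a frame
    inequality then bounds |P| below by N^2 / sum_(U, V) |w|^2 |<u_U, u_V>|^2 for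
    every family of N unitaries.

    For d >= 2m take U = q (x) Q (x) 1 on the first 2m levels, with q in a fine
    grid of SU(2) and Q among the m^2 Weyl operators.  Distinct Q are orthogonal,
    and 1 / (1 - w^2) has bounded mean over the 3-dimensional grid, so
    |P| >= m^2 / (256 eps).  Since (4 delta_1 + delta_2)^2 >= 128 eps and
    delta_4^2 >= 512 eps, this implies both claims when d >= 2; for d = 1 the
    first one says |P| >= 1 and the hypothesis of the second one fails. *)

Require Import Defs.
From mathcomp Require Import all_boot all_order all_algebra.
From mathcomp Require Import spectral sesquilinear mxtens complex.
From mathcomp Require separable cyclic cyclotomic.
From mathcomp Require Import all_classical all_reals all_analysis.
From mathcomp Require Import zify ring lra.

Set Implicit Arguments.
Unset Strict Implicit.
Unset Printing Implicit Defensive.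

Import Order.TTheory GRing.Theory Num.Theory.
Import numFieldNormedType.Exports.

Local Open Scope complex_scope.
Local Open Scope sesquilinear_scope.
Local Open Scope ring_scope.

(** * Hilbert-Schmidt geometry *)

Section HilbertSchmidt.
Variable C : numClosedFieldType.

(** Conjugate-linear in the first argument; for one column it is the inner product of vectors. *)
Definition hsdot (m n : nat) (A B : 'M[C]_(m, n)) : C := \tr (A^t* *m B).

Lemma adjmxE m n (A : 'M[C]_(m, n)) i j : (A^t*) i j = (A j i)^*.
Proof. by rewrite !mxE. Qed.

Lemma adjmxM m n p (A : 'M[C]_(m, n)) (B : 'M[C]_(n, p)) :
  (A *m B)^t* = B^t* *m A^t*.
Proof. by rewrite trmx_mul map_mxM. Qed.

Lemma adjmxZ m n (a : C) (A : 'M[C]_(m, n)) : (a *: A)^t* = a^* *: A^t*.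
Proof. by apply/matrixP => i j; rewrite !mxE rmorphM. Qed.

Lemma adjmx_sum m n (I : finType) (F : I -> 'M[C]_(m, n)) :
  (\sum_i F i)^t* = \sum_i (F i)^t*.
Proof.
apply/matrixP => i j; rewrite !mxE !summxE rmorph_sum.
by apply: eq_bigr => k _; rewrite !mxE.
Qed.

Lemma mxtraceB n (A B : 'M[C]_n) : \tr (A - B) = \tr A - \tr B.
Proof. exact: raddfB. Qed.

Lemma mxtrace_sum n (I : finType) (F : I -> 'M[C]_n) :
  \tr (\sum_i F i) = \sum_i \tr (F i).
Proof. exact: raddf_sum. Qed.

Lemma hsdotE m n (A B : 'M[C]_(m, n)) :
  hsdot A B = \sum_i \sum_j (A i j)^* * B i j.
Proof.
rewrite exchange_big /hsdot /mxtrace; apply: eq_bigr => j _.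
by rewrite mxE; apply: eq_bigr => i _; rewrite !mxE.
Qed.

Lemma hsdot_sqr m n (A : 'M[C]_(m, n)) :
  hsdot A A = \sum_i \sum_j `|A i j| ^+ 2.
Proof.
rewrite hsdotE; apply: eq_bigr => i _; apply: eq_bigr => j _.
by rewrite mulrC normCK.
Qed.

Lemma hsdot_ge0 m n (A : 'M[C]_(m, n)) : 0 <= hsdot A A.
Proof.
rewrite hsdot_sqr; apply: sumr_ge0 => i _; apply: sumr_ge0 => j _.
exact: exprn_ge0.
Qed.

Lemma hsdotDl m n (A B X : 'M[C]_(m, n)) :
  hsdot (A + B) X = hsdot A X + hsdot B X.
Proof. by rewrite /hsdot linearD /= map_mxD mulmxDl linearD. Qed.

Lemma hsdotDr m n (A B X : 'M[C]_(m, n)) :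
  hsdot X (A + B) = hsdot X A + hsdot X B.
Proof. by rewrite /hsdot mulmxDr linearD. Qed.

Lemma hsdotZr m n (a : C) (X A : 'M[C]_(m, n)) :
  hsdot X (a *: A) = a * hsdot X A.
Proof. by rewrite /hsdot -scalemxAr linearZ. Qed.

Lemma hsdot_sumr m n (I : finType) (F : I -> 'M[C]_(m, n)) X :
  hsdot X (\sum_i F i) = \sum_i hsdot X (F i).
Proof. by rewrite /hsdot mulmx_sumr raddf_sum. Qed.

Lemma hsdotC m n (A B : 'M[C]_(m, n)) : hsdot B A = (hsdot A B)^*.
Proof.
rewrite !hsdotE rmorph_sum; apply: eq_bigr => i _; rewrite rmorph_sum.
by apply: eq_bigr => j _; rewrite rmorphM /= conjCK mulrC.
Qed.

Lemma sum_cauchy_schwarz (I : finType) (f g : I -> C) :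
  `|\sum_i (f i)^* * g i| ^+ 2
    <= (\sum_i `|f i| ^+ 2) * (\sum_i `|g i| ^+ 2).
Proof.
pose v (h : I -> C) : 'rV[C]_#|I| := \row_j h (enum_val j).
have vE h h' : dotmx (v h) (v h') = \sum_i h i * (h' i)^*.
  rewrite dotmxE mxE (reindex _ (onW_bij _ (enum_val_bij I))) /=.
  by apply: eq_bigr => j _; rewrite !mxE.
(* [dotmx] conjugates its second argument, hence the order [g], [f]. *)
have : `|dotmx (v g) (v f)| ^+ 2 <= dotmx (v g) (v g) * dotmx (v f) (v f).
  by have [] := CauchySchwarz (@dotmx C #|I|) (v g) (v f).
rewrite !vE mulrC; congr (_ <= _); last first.
  by congr (_ * _); apply: eq_bigr => i _; rewrite normCK.
by congr (`|_| ^+ 2); apply: eq_bigr => i _; rewrite mulrC.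
Qed.

Lemma hsdot_cauchy_schwarz m n (A B : 'M[C]_(m, n)) :
  `|hsdot A B| ^+ 2 <= hsdot A A * hsdot B B.
Proof.
rewrite !hsdot_sqr hsdotE !pair_big /=.
exact: (sum_cauchy_schwarz (fun x => A x.1 x.2) (fun x => B x.1 x.2)).
Qed.

Lemma hsdot_le m n (A B : 'M[C]_(m, n)) (a b : C) :
  0 <= a -> 0 <= b -> hsdot A A <= a ^+ 2 -> hsdot B B <= b ^+ 2 ->
  `|hsdot A B| <= a * b.
Proof.
move=> a0 b0 Aa Bb; rewrite -(@ler_pXn2r _ 2) ?nnegrE ?mulr_ge0 //.
apply: le_trans (hsdot_cauchy_schwarz A B) _.
by rewrite exprMn ler_pM // hsdot_ge0.
Qed.

Lemma hsdot_mulmxr_isometry m n (A : 'M[C]_(m, n)) (J : 'M[C]_n) (c : C) :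
  J^t* *m J = c%:M -> hsdot (A *m J^t*) (A *m J^t*) = c * hsdot A A.
Proof.
move=> JJ; rewrite /hsdot adjmxM trmxCK.
rewrite mxtrace_mulC -!mulmxA (mulmxA (J^t*)) JJ mul_scalar_mx -scalemxAr.
by rewrite mxtraceZ mxtrace_mulC.
Qed.

End HilbertSchmidt.

(** * Frame inequality *)

Section FrameBound.
Variable C : numClosedFieldType.

(* tr(P S) <= |P| |S| for P = E E^* and S = M M^* *)
Lemma projection_bound m p N (E : 'M[C]_(m, p)) (M : 'M[C]_(m, N)) (c : C) :
  E^t* *m E = c%:M ->
  hsdot (E^t* *m M) (E^t* *m M) ^+ 2
    <= c ^+ 2 * p%:R * hsdot (M^t* *m M) (M^t* *m M).
Proof.
move=> EE; have frobE n (X : 'M[C]_(m, n)) :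
    hsdot (X *m X^t*) (X *m X^t*) = hsdot (X^t* *m X) (X^t* *m X).
  rewrite /hsdot !adjmxM !trmxCK -!mulmxA mxtrace_mulC.
  by rewrite -!mulmxA.
have key : hsdot (E^t* *m M) (E^t* *m M) = hsdot (E *m E^t*) (M *m M^t*).
  by rewrite /hsdot !adjmxM !trmxCK -!mulmxA mxtrace_mulC -!mulmxA.
have := hsdot_cauchy_schwarz (E *m E^t*) (M *m M^t*).
rewrite -key !frobE ger0_norm ?hsdot_ge0 //.
suff -> : hsdot (E^t* *m E) (E^t* *m E) = c ^+ 2 * p%:R by [].
rewrite {1}/hsdot {2}EE mul_mx_scalar linearZ /=.
rewrite adjmxM trmxCK EE mxtrace_scalar.
by rewrite mulr_natr expr2 mulrnAr.
Qed.


(** Flattening the matrices into columns of [Em] and [Dm] turns [projection_bound] into a statement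
    about inner products. For [D i] in the span of the [E b] this is the Welch bound in dimension
    [p]. *)
Lemma frame_bound (T : finType) m k p (E : 'I_p -> 'M[C]_(m, k))
    (D : T -> 'M[C]_(m, k)) (c : C) :
  (forall a b, hsdot (E a) (E b) = c *+ (a == b)) ->
  (\sum_i \sum_b `|hsdot (E b) (D i)| ^+ 2) ^+ 2
    <= c ^+ 2 * p%:R * \sum_i \sum_j `|hsdot (D i) (D j)| ^+ 2.
Proof.
move=> EE; pose Em := \matrix_(x < m * k, b < p) mxvec (E b) 0 x.
pose Dm := \matrix_(x < m * k, i < #|T|) mxvec (D (enum_val i)) 0 x.
have vecE (A B : 'M[C]_(m, k)) :
    \sum_x (mxvec A 0 x)^* * mxvec B 0 x = hsdot A B.
  rewrite hsdotE pair_big (reindex _ (curry_mxvec_bij m k)) /=.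
  by apply: eq_bigr => -[i j] _; rewrite /= !mxvecE.
have tE : Em^t* *m Em = c%:M.
  apply/matrixP => a b; rewrite !mxE -EE -vecE.
  by apply: eq_bigr => x _; rewrite !mxE.
have := projection_bound Dm tE; rewrite !hsdot_sqr.
have sumT (F : T -> C) : \sum_(i < #|T|) F (enum_val i) = \sum_i F i.
  by rewrite [RHS](reindex _ (onW_bij _ (enum_val_bij T))).
congr (_ ^+ 2 <= _ * _); last first.
  rewrite -sumT; apply: eq_bigr => i _; rewrite -sumT; apply: eq_bigr => j _.
  by rewrite mxE -vecE; congr (`|_| ^+ 2); apply: eq_bigr => x _; rewrite !mxE.
rewrite exchange_big -sumT; apply: eq_bigr => i _; apply: eq_bigr => j _.
by rewrite mxE -vecE; congr (`|_| ^+ 2); apply: eq_bigr => x _; rewrite !mxE.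
Qed.

(* The p frame vectors E_b span every A_i, so D_i keeps its A_i component after
   projection onto that span. *)
Lemma program_dimension_bound (T : finType) m k p (E : 'I_p -> 'M[C]_(m, k))
    (psi : T -> 'I_p -> C) (D : T -> 'M[C]_(m, k)) (f : C) :
  (0 < k)%N -> 0 <= f ->
  (forall a b, hsdot (E a) (E b) = k%:R *+ (a == b)) ->
  (forall i, \sum_b `|psi i b| ^+ 2 = 1) ->
  (forall i, k%:R * f <= `|hsdot (\sum_b psi i b *: E b) (D i)|) ->
  #|T|%:R ^+ 2 * f ^+ 4 * k%:R ^+ 2
    <= p%:R * \sum_i \sum_j `|hsdot (D i) (D j)| ^+ 2.
Proof.
move=> k0 f0 EE psi1 AD.
have kR : 0 < k%:R :> C by rewrite ltr0n.
(* The extra [k ^ 2] is the [c ^ 2] of [frame_bound]: each [E b] has squared norm [k]. *)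
rewrite -(ler_pM2l (exprn_gt0 2 kR)) [leRHS]mulrA.
apply: le_trans (frame_bound D EE).
have -> : k%:R ^+ 2 * (#|T|%:R ^+ 2 * f ^+ 4 * k%:R ^+ 2)
    = (#|T|%:R * (k%:R * f) ^+ 2) ^+ 2 :> C.
  by ring.
rewrite ler_pXn2r ?nnegrE //.
- rewrite mulr_natl -sumr_const; apply: ler_sum => i _.
  apply: (le_trans (y := `|hsdot (\sum_b psi i b *: E b) (D i)| ^+ 2)).
    by rewrite ler_pXn2r ?nnegrE ?mulr_ge0 ?ler0n.
  have -> : hsdot (\sum_b psi i b *: E b) (D i)
      = \sum_b (psi i b)^* * hsdot (E b) (D i).
    rewrite hsdotC hsdot_sumr rmorph_sum; apply: eq_bigr => b _.
    by rewrite hsdotZr rmorphM /= -hsdotC.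
  (* [psi i] is a unit vector, so a single combination of the [E b] sees at most the weight of [D i]
     on all of them. *)
  apply: le_trans (sum_cauchy_schwarz _ _) _.
  by rewrite psi1 mul1r.
- by rewrite mulr_ge0 ?ler0n // exprn_ge0 // mulr_ge0 ?ler0n.
by apply: sumr_ge0 => i _; apply: sumr_ge0 => b _; exact: exprn_ge0.
Qed.

End FrameBound.

(** * Overlap of residual program vectors *)

Section ResidualOverlap.
Variable C : numClosedFieldType.

(* Testing A1^* A2 = c against the traceless J = W^* - w kills the left-hand
   side and isolates the residual overlap s in D1^* D2 = s W. *)
Lemma residual_overlap n k (A1 A2 D1 D2 : 'M[C]_(n, k)) (W : 'M[C]_k)
    (c s w t : C) :
  (0 < k)%N -> 0 <= t -> w^* = w -> w ^+ 2 < 1 ->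
  A1^t* *m A2 = c%:M -> D1^t* *m D2 = s *: W ->
  W^t* *m W = 1%:M -> W + W^t* = (2 * w)%:M -> \tr W = w * k%:R ->
  hsdot D1 D1 <= k%:R -> hsdot D2 D2 <= k%:R ->
  hsdot (A1 - D1) (A1 - D1) <= k%:R * t ^+ 2 ->
  hsdot (A2 - D2) (A2 - D2) <= k%:R * t ^+ 2 ->
  `|s| ^+ 2 * (1 - w ^+ 2) <= (2 * t + t ^+ 2) ^+ 2.
Proof.
move=> k0 t0 wreal w1 A12 D12 WW Wre trW D1k D2k B1k B2k.
have kR : 0 < k%:R :> C by rewrite ltr0n.
have v0 : 0 < 1 - w ^+ 2 by rewrite subr_gt0.
set q := sqrtC (k%:R : C); set r := sqrtC (1 - w ^+ 2).
have q2 : q ^+ 2 = k%:R by rewrite sqrtCK.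
have r2 : r ^+ 2 = 1 - w ^+ 2 by rewrite sqrtCK.
have q0 : 0 <= q by rewrite sqrtC_ge0 ler0n.
have r0 : 0 < r by rewrite sqrtC_gt0.
pose J := W^t* - w%:M.
have Jadj : J^t* = W - w%:M.
  by rewrite /J linearB /= map_mxB trmxCK tr_scalar_mx map_scalar_mx /= wreal.
(* The cross terms combine to [w] times [W + W^t*], which is scalar; so [J] is [r] times a
   unitary. *)
have JJ : J^t* *m J = (1 - w ^+ 2)%:M.
  rewrite Jadj /J mulmxBl !mulmxBr (mulmx1C WW) mul_scalar_mx mul_mx_scalar.
  rewrite -scalar_mxM opprB addrACA -opprD -scalerDr Wre scale_scalar_mx.
  rewrite -raddfN -!raddfD.
  by have -> : 1 - w ^+ 2 = 1 + w * w - w * (2 * w) by ring.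
have trJ : \tr J = 0.
  have /(congr1 mxtrace) := Wre; rewrite linearD /= trW mxtrace_scalar => e.
  have -> : \tr J = \tr (W^t*) - w * k%:R.
    by rewrite /J linearB /= mxtrace_scalar mulr_natr.
  apply/eqP; rewrite subr_eq0; apply/eqP; apply: (addrI (w * k%:R)).
  by rewrite e -[_ *+ k]mulr_natr -mulrA mulr_natl mulr2n.
have JD (X Y : 'M[C]_(n, k)) : hsdot (X *m J^t*) Y = \tr (J *m (X^t* *m Y)).
  by rewrite /hsdot adjmxM trmxCK mulmxA.
have bound (X Y : 'M[C]_(n, k)) (a b : C) : 0 <= a -> 0 <= b ->
    hsdot X X <= k%:R * a ^+ 2 -> hsdot Y Y <= k%:R * b ^+ 2 ->
    `|hsdot (X *m J^t*) Y| <= k%:R * r * (a * b).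
  move=> a0 b0 Xa Yb; have -> : k%:R * r * (a * b) = (r * (q * a)) * (q * b).
    rewrite -q2; ring.
  apply: hsdot_le; rewrite ?mulr_ge0 ?(ltW r0) //.
    rewrite (hsdot_mulmxr_isometry X JJ) exprMn r2 exprMn q2.
    by rewrite ler_pM2l.
  by rewrite exprMn q2.
have main : s * (k%:R * r ^+ 2) = - (hsdot (D1 *m J^t*) (A2 - D2)
    + hsdot ((A1 - D1) *m J^t*) D2 + hsdot ((A1 - D1) *m J^t*) (A2 - D2)).
  have : hsdot (A1 *m J^t*) A2 = 0.
    by rewrite JD A12 mul_mx_scalar linearZ /= trJ mulr0.
  rewrite -{1}(subrK D1 A1) -{1}(subrK D2 A2) mulmxDl hsdotDl !hsdotDr.
  have -> : hsdot (D1 *m J^t*) D2 = s * (k%:R * r ^+ 2).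
    rewrite JD D12 -scalemxAr linearZ /= /J mulmxBl WW mul_scalar_mx.
    by rewrite linearB linearZ /= trW mxtrace1 r2; congr (_ * _); ring.
  move=> e; apply/eqP; rewrite -subr_eq0 opprK -e; apply/eqP; ring.
have : `|s * (k%:R * r ^+ 2)| <= k%:R * r * (2 * t + t ^+ 2).
  rewrite main normrN.
  apply: le_trans (ler_normD _ _) _.
  have -> : k%:R * r * (2 * t + t ^+ 2)
    = k%:R * r * (1 * t) + k%:R * r * (t * 1) + k%:R * r * (t * t) by ring.
  apply: lerD; last by apply: bound.
  apply: le_trans (ler_normD _ _) _.
  by apply: lerD; apply: bound; rewrite // expr1n mulr1.
rewrite normrM (ger0_norm (x := k%:R * r ^+ 2)); last first.
  by rewrite mulr_ge0 ?ler0n // exprn_ge0 // ltW.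
have -> : `|s| * (k%:R * r ^+ 2) = (k%:R * r) * (`|s| * r) by ring.
rewrite ler_pM2l ?mulr_gt0 // => sr.
have sr0 : 0 <= `|s| * r by rewrite mulr_ge0 // ltW.
by rewrite -r2 -exprMn ler_pXn2r // nnegrE // (le_trans sr0).
Qed.

End ResidualOverlap.

(** * Program runs and product runs *)

Section ProgramSlices.
Variable C : numClosedFieldType.

(* prog_run G psi is the restriction of phi |-> G (phi (x) psi) to the first k
   levels of the data register, and prod_run V u is phi |-> V phi (x) u. *)
Definition prog_slice (k r p : nat) (G : 'M[C]_((k + r) * p)) (b : 'I_p) :
    'M[C]_((k + r) * p, k) :=
  \matrix_(x, j) G x (mxtens_index (lshift r j, b)).

Definition prog_run (k r p : nat) (G : 'M[C]_((k + r) * p)) (psi : 'cV[C]_p) :=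
  \sum_b psi b 0 *: prog_slice G b.

Definition prod_run (d k p : nat) (V : 'M[C]_(d, k)) (u : 'cV[C]_p) :
    'M[C]_(d * p, k) :=
  \matrix_(x, j) (V (mxtens_unindex x).1 j * u (mxtens_unindex x).2 0).

Lemma sum_mxtens (m n : nat) (F : 'I_(m * n) -> C) :
  \sum_x F x = \sum_i \sum_j F (mxtens_index (i, j)).
Proof.
rewrite pair_big /= (reindex (@mxtens_index m n)) /=.
  by apply: eq_bigr => -[].
by exists (@mxtens_unindex m n) => x _; rewrite ?mxtens_indexK ?mxtens_unindexK.
Qed.

(** The columns of all slices together are distinct columns of the unitary [G]. *)
Lemma prog_slice_orthonormal k r p (G : 'M[C]_((k + r) * p)) a b :
  G \is unitarymx ->
  (prog_slice G a)^t* *m prog_slice G b = ((a == b)%:R)%:M.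
Proof.
move=> /unitarymxP/mulmx1C GG; apply/matrixP => i j.
have /matrixP/(_ (mxtens_index (lshift r i, a)))
  /(_ (mxtens_index (lshift r j, b))) := GG.
rewrite !mxE (can_eq (@mxtens_indexK _ _)) xpair_eqE (inj_eq (@lshift_inj _ _)).
move=> GGij; transitivity (((i == j) && (a == b))%:R : C).
  by rewrite -GGij; apply: eq_bigr => x _; rewrite !mxE.
by rewrite andbC; case: (a == b); case: (i == j).
Qed.

Lemma prog_run_gram k r p (G : 'M[C]_((k + r) * p)) (psi phi : 'cV[C]_p) :
  G \is unitarymx ->
  (prog_run G psi)^t* *m prog_run G phi = (hsdot psi phi)%:M.
Proof.
move=> Gu; rewrite /prog_run adjmx_sum mulmx_suml hsdotE raddf_sum /=.
apply: eq_bigr => a _; rewrite big_ord1 mulmx_sumr (bigD1 a) //=.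
rewrite big1 ?addr0 => [|b ba]; rewrite adjmxZ -scalemxAl.
  by rewrite -scalemxAr prog_slice_orthonormal // eqxx !scale_scalar_mx mulr1.
rewrite -scalemxAr prog_slice_orthonormal // eq_sym (negPf ba).
by rewrite !scale_scalar_mx !mulr0 raddf0.
Qed.

Lemma prod_run_gram d k p (V W : 'M[C]_(d, k)) (u v : 'cV[C]_p) :
  (prod_run V u)^t* *m prod_run W v = hsdot u v *: (V^t* *m W).
Proof.
apply/matrixP => i j; rewrite !mxE sum_mxtens hsdotE exchange_big /= mulr_suml.
apply: eq_bigr => c _; rewrite big_ord1 mulr_sumr; apply: eq_bigr => a _.
by rewrite !mxE !mxtens_indexK /= rmorphM /= mulrACA mulrC.
Qed.

End ProgramSlices.

(** * Trace norm tested against unitaries *)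

Section TraceNorm.
Variable C : numClosedFieldType.

(** [P^t*] holds the right singular vectors of [A], so the columns of [A *m P^t*] are orthogonal. *)
Lemma spectral_gram n (A : 'M[C]_n) (P := spectralmx (A^t* *m A)) :
  (A *m P^t*)^t* *m (A *m P^t*) = diag_mx (spectral_diag (A^t* *m A)).
Proof.
have Pu : P \is unitarymx by exact: spectral_unitarymx.
have PP : P *m P^t* = 1%:M by apply/unitarymxP.
have /orthomx_spectralP HE : A^t* *m A \is normalmx.
  by apply/normalmxP; rewrite adjmxM trmxCK.
rewrite adjmxM trmxCK mulmxA -(mulmxA P) {1}HE -/P (invmx_unitary Pu).
by rewrite !mulmxA PP mul1mx -mulmxA PP mulmx1.
Qed.

Lemma spectral_diag_gram_ge0 n (A : 'M[C]_n) i :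
  0 <= spectral_diag (A^t* *m A) 0 i.
Proof.
have /matrixP/(_ i i) := spectral_gram A; rewrite !mxE eqxx mulr1n => <-.
by apply: sumr_ge0 => j _; rewrite !mxE mulrC -normCK exprn_ge0.
Qed.

(** One direction of trace norm duality. Inserting [P^t* *m P] makes each diagonal entry the product
    of a unit row of [P *m Z] and a column of [A *m P^t*] whose norm is a singular value. *)
Lemma trace_unitary_le n (A Z : 'M[C]_n) :
  Z \is unitarymx ->
  `|\tr (Z *m A)| <= \sum_i sqrtC (spectral_diag (A^t* *m A) 0 i).
Proof.
move=> Zu; pose P := spectralmx (A^t* *m A).
have XX := spectral_gram A; rewrite -/P in XX.
have Pu : P \is unitarymx by exact: spectral_unitarymx.
have PP : P *m P^t* = 1%:M by apply/unitarymxP.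
have YY : (P *m Z) *m (P *m Z)^t* = 1%:M.
  by apply/unitarymxP; rewrite mul_unitarymx.
have -> : \tr (Z *m A) = \tr (P *m Z *m (A *m P^t*)).
  by rewrite mulmxA [RHS]mxtrace_mulC !mulmxA (mulmx1C PP) mul1mx.
rewrite /mxtrace; apply: le_trans (ler_norm_sum _ _ _) _.
apply: ler_sum => i _.
set X := A *m P^t* in XX *; set Y := P *m Z in YY *.
have Xi : \sum_j `|X j i| ^+ 2 = spectral_diag (A^t* *m A) 0 i.
  have /matrixP/(_ i i) := XX; rewrite !mxE eqxx mulr1n => <-.
  by apply: eq_bigr => j _; rewrite !mxE normCK mulrC.
have Yi : \sum_j `|(Y i j)^*| ^+ 2 = 1.
  have /matrixP/(_ i i) := YY; rewrite !mxE eqxx mulr1n => <-.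
  by apply: eq_bigr => j _; rewrite !mxE norm_conjC normCK.
have := sum_cauchy_schwarz (fun j => (Y i j)^*) (fun j => X j i).
rewrite Yi Xi mul1r.
have -> : \sum_j ((Y i j)^*)^* * X j i = (Y *m X) i i.
  by rewrite mxE; apply: eq_bigr => j _; rewrite conjCK.
move=> le; rewrite -[leLHS]sqrCK //.
by rewrite ler_sqrtC ?nnegrE ?exprn_ge0 ?spectral_diag_gram_ge0.
Qed.

(** [Psi *m Psi^t*] is [k] times a projection, so this is a self-adjoint involution. *)
Lemma reflection_unitary n (Psi : 'cV[C]_n) (k : C) :
  k != 0 -> k^* = k -> hsdot Psi Psi = k ->
  1%:M - (2 / k) *: (Psi *m Psi^t*) \is unitarymx.
Proof.
move=> k0 kreal Pk; apply/unitarymxP; set Q := Psi *m Psi^t*.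
have QQ : Q *m Q = k *: Q.
  rewrite /Q mulmxA -(mulmxA Psi) [Psi^t* *m Psi]mx11_scalar.
  by rewrite -trace_mx11 -/(hsdot Psi Psi) Pk mul_mx_scalar -scalemxAl.
have Qadj : (1%:M - (2 / k) *: Q)^t* = 1%:M - (2 / k) *: Q.
  rewrite linearB /= map_mxB trmx1 map_mx1; congr (_ - _).
  rewrite adjmxZ /Q adjmxM trmxCK rmorphM fmorphV /= kreal.
  by rewrite rmorph_nat.
rewrite Qadj mulmxBl mul1mx !mulmxBr mulmx1 -scalemxAl -scalemxAr QQ.
have aak : 2 / k * (2 / k * k) = 2 / k + 2 / k.
  by rewrite divfK // mulrDr !mulr1.
by rewrite !scalerA -mulrA aak scalerDl opprB addrK subrK.
Qed.

End TraceNorm.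

(** * Entanglement fidelity of a run *)

Section EntanglementFidelity.
Variables (C : numClosedFieldType) (d k p : nat).
Variables (A : 'M[C]_(d * p, k)) (V : 'M[C]_(d, k)).

(** The image under [X (x) 1] of the unnormalized maximally entangled vector on [k] levels. *)
Definition choi_vec (X : 'M[C]_(d, k)) : 'cV[C]_(d * k) :=
  \col_x X (mxtens_unindex x).1 (mxtens_unindex x).2.

(** The Kraus operator of outcome [c] on the program register. *)
Definition run_slice (c : 'I_p) : 'M[C]_(d, k) :=
  \matrix_(i, a) A (mxtens_index (i, c)) a.

(* The Choi matrix, normalized to trace 1, of the channel with isometry A
   minus that of X |-> V X V^*. *)
Definition choi_diff : 'M[C]_(d * k) :=
  k%:R^-1 *: (\sum_c choi_vec (run_slice c) *m (choi_vec (run_slice c))^t*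
              - choi_vec V *m (choi_vec V)^t*).

(** The least-squares choice of [u] when [A] is approximated by [prod_run V u]; its squared norm is
    the entanglement fidelity. *)
Definition residual_vec : 'cV[C]_p := \col_c (k%:R^-1 * hsdot V (run_slice c)).

Hypotheses (k_gt0 : (0 < k)%N) (AA : A^t* *m A = 1%:M) (VV : V^t* *m V = 1%:M).

Let kR : 0 < k%:R :> C. Proof. by rewrite ltr0n. Qed.

Lemma choi_vecE X i a : choi_vec X (mxtens_index (i, a)) 0 = X i a.
Proof. by rewrite mxE mxtens_indexK. Qed.

Lemma choi_vec_hsdot X Y : hsdot (choi_vec X) (choi_vec Y) = hsdot X Y.
Proof.
rewrite !hsdotE sum_mxtens; apply: eq_bigr => i _; apply: eq_bigr => a _.
by rewrite big_ord1 !mxE !mxtens_indexK.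
Qed.

Lemma run_slice_sum : \sum_c hsdot (run_slice c) (run_slice c) = k%:R.
Proof.
transitivity (hsdot A A); last by rewrite /hsdot AA mxtrace1.
rewrite hsdotE sum_mxtens [RHS]exchange_big /=; apply: eq_bigr => c _.
rewrite hsdotE; apply: eq_bigr => i _; apply: eq_bigr => a _.
by rewrite !mxE.
Qed.

Lemma hsdot_isometry : hsdot V V = k%:R.
Proof. by rewrite /hsdot VV mxtrace1. Qed.

(* As choi_diff is traceless, testing it against this unitary rather than against
   the projection onto choi_vec V gains a factor 2. *)
Lemma choi_diff_reflection :
  \tr ((1%:M - (2 / k%:R) *: (choi_vec V *m (choi_vec V)^t*)) *m choi_diff)
    = 2 * (1 - hsdot residual_vec residual_vec).
Proof.
have trvv m (x y : 'cV[C]_m) : \tr (x *m y^t*) = hsdot y x.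
  by rewrite mxtrace_mulC.
have tr0 : \tr choi_diff = 0.
  rewrite /choi_diff mxtraceZ mxtraceB mxtrace_sum.
  under eq_bigr do rewrite trvv choi_vec_hsdot.
  by rewrite run_slice_sum trvv choi_vec_hsdot hsdot_isometry subrr mulr0.
rewrite mulmxBl mul1mx mxtraceB tr0 sub0r -scalemxAl mxtraceZ /choi_diff.
rewrite -scalemxAr mxtraceZ mulmxBr mxtraceB mulmx_sumr mxtrace_sum.
have quad (x y : 'cV[C]_(d * k)) :
    \tr (x *m x^t* *m (y *m y^t*)) = hsdot x y * hsdot y x.
  rewrite -mulmxA (mulmxA (x^t*)) [x^t* *m y]mx11_scalar -trace_mx11.
  by rewrite mul_scalar_mx -scalemxAr mxtraceZ trvv.
rewrite quad !choi_vec_hsdot hsdot_isometry.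
have -> : \sum_c \tr (choi_vec V *m (choi_vec V)^t* *m
      (choi_vec (run_slice c) *m (choi_vec (run_slice c))^t*))
    = k%:R ^+ 2 * hsdot residual_vec residual_vec.
  rewrite hsdot_sqr mulr_sumr; apply: eq_bigr => c _.
  rewrite big_ord1 quad !choi_vec_hsdot [hsdot _ V]hsdotC -normCK mxE.
  rewrite normrM exprMn mulrA normfV (ger0_norm (ltW kR)) exprVn.
  rewrite divff ?mul1r //.
  by rewrite expf_neq0 // gt_eqF.
by field; rewrite gt_eqF.
Qed.

Lemma residual_fidelity :
  2 * (1 - hsdot residual_vec residual_vec)
    <= \sum_x sqrtC (spectral_diag (choi_diff^t* *m choi_diff) 0 x).
Proof.
rewrite -choi_diff_reflection; apply: le_trans (trace_unitary_le _ _).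
  apply: real_ler_norm; rewrite choi_diff_reflection.
  by rewrite rpredM ?realn // rpredB ?real1 // ger0_real // hsdot_ge0.
apply: reflection_unitary; first by rewrite gt_eqF.
  by rewrite conj_Creal // realn.
by rewrite choi_vec_hsdot hsdot_isometry.
Qed.

Lemma prod_run_residual_sqr :
  hsdot (prod_run V residual_vec) (prod_run V residual_vec)
    = k%:R * hsdot residual_vec residual_vec.
Proof.
by rewrite {1}/hsdot prod_run_gram VV mxtraceZ mxtrace1 mulrC.
Qed.

(** The normal equation of least squares: with [prod_run_residual_sqr] it makes the error orthogonal
    to the product run. *)
Lemma run_residual :
  hsdot A (prod_run V residual_vec) = k%:R * hsdot residual_vec residual_vec.
Proof.
rewrite hsdotE sum_mxtens exchange_big /= hsdotE mulr_sumr.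
apply: eq_bigr => c _; rewrite big_ord1.
transitivity (hsdot (run_slice c) V * residual_vec c 0).
  rewrite hsdotE mulr_suml; apply: eq_bigr => i _.
  rewrite mulr_suml; apply: eq_bigr => a _.
  by rewrite [prod_run _ _ _ _]mxE [run_slice _ _ _]mxE mxtens_indexK mulrA.
rewrite mulrA; congr (_ * _); rewrite mxE rmorphM fmorphV rmorph_nat /= -hsdotC.
by rewrite mulVKf ?gt_eqF.
Qed.

(** Pythagoras: [A - D] is orthogonal to [D], and [A] has squared norm [k]. *)
Lemma residual_error (D := prod_run V residual_vec) :
  hsdot (A - D) (A - D)
    = k%:R * (1 - hsdot residual_vec residual_vec).
Proof.
set f := hsdot residual_vec _.
have DD : hsdot D D = k%:R * f by exact: prod_run_residual_sqr.
have AD : hsdot A D = k%:R * f by exact: run_residual.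
have freal : f^* = f by rewrite conj_Creal // ger0_real // hsdot_ge0.
have DA : hsdot D A = k%:R * f.
  by rewrite hsdotC AD rmorphM rmorph_nat /= freal.
have ArunA : hsdot A A = k%:R by rewrite /hsdot AA mxtrace1.
have := ArunA; move: (A - D) (esym (subrK D A)) => B AE.
have BD : hsdot B D = 0.
  by apply: (addIr (hsdot D D)); rewrite -hsdotDl -AE AD DD add0r.
have DB : hsdot D B = 0.
  by apply: (addIr (hsdot D D)); rewrite -hsdotDr -AE DA DD add0r.
rewrite AE hsdotDl !hsdotDr BD DB add0r addr0 DD => /(canRL (addrK _)) ->.
by rewrite mulrBr mulr1.
Qed.

End EntanglementFidelity.

(** * Extending a unitary by the identity *)

Section UnitaryPadding.
Variable C : numClosedFieldType.

Lemma col_mx0_gram k r (S T : 'M[C]_k) :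
  (col_mx S (0 : 'M[C]_(r, k)))^t* *m col_mx T 0 = S^t* *m T.
Proof.
by rewrite tr_col_mx map_row_mx mul_row_col mulmx0 addr0.
Qed.

Lemma block_mx1_unitary k r (S : 'M[C]_k) :
  S \is unitarymx -> block_mx S 0 0 (1%:M : 'M[C]_r) \is unitarymx.
Proof.
move=> /unitarymxP SS; apply/unitarymxP.
rewrite tr_block_mx map_block_mx mulmx_block SS trmx1 map_mx1 !trmx0 !map_mx0.
by rewrite !mulmx0 !mul0mx mulmx1 !addr0 add0r -scalar_mx_block.
Qed.

End UnitaryPadding.

(** * Residual program vectors *)

Section Quantum.
Variable R : realType.
Local Notation C := R[i].

(** The eigenvalues of [A^t* *m A] are nonnegative reals, so taking real parts in [trace_norm] loses
    nothing. *)
Lemma trace_normE n (A : 'M[C]_n) :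
  (trace_norm A)%:C = \sum_i sqrtC (spectral_diag (A^t* *m A) 0 i).
Proof.
rewrite /trace_norm rmorph_sum; apply: eq_bigr => i _ /=.
have := spectral_diag_gram_ge0 A i.
set z := spectral_diag _ _ _ => z0.
have zE : z = (complex.Re z)%:C by rewrite RRe_real // ger0_real.
have Rz0 : 0 <= complex.Re z by rewrite -lecR -zE.
apply/eqP; rewrite -(@eqrXn2 _ 2) ?sqrtC_ge0 //; last first.
  by rewrite lecR sqrtr_ge0.
by rewrite sqrtCK -rmorphXn /= sqr_sqrtr // -zE.
Qed.

Lemma tens_idE a b e (f : {linear 'M[C]_a -> 'M[C]_b}) X i j k l :
  tens_id f X (mxtens_index (i, k)) (mxtens_index (j, l))
    = f (@aux_block _ a e X k l) i j.
Proof.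
rewrite /tens_id summxE (bigD1 k) //= summxE (bigD1 l) //=.
rewrite tensmxE mxE !eqxx mulr1 !big1 ?addr0 // => [k' k'k|l' l'l].
  rewrite summxE big1 // => l' _.
  by rewrite tensmxE mxE eq_sym (negPf k'k) mulr0.
by rewrite tensmxE mxE (eq_sym l) (negPf l'l) andbF mulr0.
Qed.

(** The reference of dimension [k] is entangled with only the first [k] of the [k + r] data
    levels. *)
Definition max_entangled (k r : nat) : 'M[C]_((k + r) * k) :=
  k%:R^-1 *: (choi_vec (col_mx 1%:M 0) *m (choi_vec (col_mx 1%:M 0))^t*).

Lemma max_entangled_state k r : (0 < k)%N -> quantum_state (max_entangled k r).
Proof.
move=> k0; split; last first.
  rewrite /max_entangled linearZ /= mxtrace_mulC -/(hsdot _ _) choi_vec_hsdot.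
  rewrite /hsdot col_mx0_gram trmx1 map_mx1 mul1mx mxtrace1 mulVf //.
  by rewrite pnatr_eq0 -lt0n.
move=> v; rewrite /max_entangled -scalemxAr -scalemxAl mxE.
apply: mulr_ge0; first by rewrite invr_ge0 ler0n.
set w := choi_vec _.
have -> : v^t* *m (w *m w^t*) *m v = (w^t* *m v)^t* *m (w^t* *m v).
  by rewrite adjmxM trmxCK !mulmxA.
by rewrite -trace_mx11 hsdot_ge0.
Qed.

Lemma aux_block_max_entangled k r (a b : 'I_k) :
  aux_block (max_entangled k r) a b
    = k%:R^-1 *: delta_mx (lshift r a) (lshift r b).
Proof.
have col1E x (c : 'I_k) :
    col_mx 1%:M (0 : 'M[C]_(r, k)) x c = (x == lshift r c)%:R.
  case: (split_ordP x) => [y ->|y ->]; first by rewrite col_mxEu mxE eq_shift.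
  by rewrite col_mxEd mxE eq_shift.
apply/matrixP => i j; rewrite [LHS]mxE /max_entangled mxE [RHS]mxE.
congr (_ * _); rewrite mxE big_ord1 adjmxE !choi_vecE !col1E mxE.
by rewrite conjC_nat -natrM mulnb.
Qed.

Lemma programmed_map_delta k r p (G : 'M[C]_((k + r) * p)) psi a b i j :
  programmed_map G psi (delta_mx (lshift r a) (lshift r b)) i j
    = \sum_c prog_run G psi (mxtens_index (i, c)) a
        * (prog_run G psi (mxtens_index (j, c)) b)^*.
Proof.
(* [K a'] is level [a'] tensor [psi]; [G] maps it to column [a'] of the program run. *)
pose K (a' : 'I_k) : 'cV[C]_((k + r) * p) := \col_y
  (((mxtens_unindex y).1 == lshift r a')%:R * psi (mxtens_unindex y).2 0).
have -> : programmed_map G psi (delta_mx (lshift r a) (lshift r b))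
    = ptrace_r ((G *m K a) *m (G *m K b)^t*).
  rewrite /programmed_map adjmxM !mulmxA -(mulmxA G (K a)).
  congr (ptrace_r (_ *m _ *m _)).
  apply/matrixP => x y; rewrite !mxE !big_ord1 !mxE.
  by rewrite rmorphM /= conjC_nat -mulnb natrM mulrACA.
have GK a' x : (G *m K a') x 0 = prog_run G psi x a'.
  rewrite mxE sum_mxtens /prog_run summxE exchange_big /=.
  apply: eq_bigr => c _.
  rewrite (bigD1 (lshift r a')) //= big1 => [|l /negPf la].
    by rewrite !mxE mxtens_indexK /= eqxx mul1r addr0 mulrC.
  by rewrite mxE mxtens_indexK /= la mul0r mulr0.
rewrite /ptrace_r summxE; apply: eq_bigr => c _.
by rewrite mxE mxE big_ord1 adjmxE !GK.
Qed.

Lemma tens_id_max_entangled k r p (G : 'M[C]_((k + r) * p)) psi (S : 'M[C]_k) :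
  tens_id (programmed_map G psi \- unitary_map (block_mx S 0 0 1%:M))%R
      (max_entangled k r)
    = choi_diff (prog_run G psi) (col_mx S 0).
Proof.
apply/matrixP => x y.
case: (mxtens_indexP x) => i a; case: (mxtens_indexP y) => j b.
rewrite tens_idE aux_block_max_entangled linearZ /= mxE [RHS]mxE; congr (_ * _).
rewrite mxE [RHS]mxE summxE; congr (_ + _).
  rewrite programmed_map_delta; apply: eq_bigr => c _.
  by rewrite mxE big_ord1 adjmxE !choi_vecE ![run_slice _ _ _ _]mxE.
rewrite mxE [RHS]mxE; congr (- _).
rewrite [RHS]mxE big_ord1 adjmxE !choi_vecE.
rewrite /unitary_map -(mul_delta_mx (0 : 'I_1)) mulmxA -mulmxA mxE big_ord1.
rewrite -colE -rowE ![col _ _ _ _]mxE ![row _ _ _ _]mxE adjmxE.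
by rewrite !block_mxEh !row_mxEl.
Qed.

(** The maximally entangled state is one input in the supremum defining the diamond norm; its output
    difference is a [choi_diff], whose trace norm bounds the infidelity. *)
Lemma processor_residual k r p (eps : R) (G : 'M[C]_((k + r) * p))
    (S : 'M[C]_k) :
  (0 < k)%N -> universal_processor eps G -> S \is unitarymx ->
  exists psi : 'cV[C]_p, hsdot psi psi = 1 /\
    1 - (eps / 2)%:C <= hsdot (residual_vec (prog_run G psi) (col_mx S 0))
                              (residual_vec (prog_run G psi) (col_mx S 0)).
Proof.
move=> k0 [Gu GU] Su; have [psi [psi1 dia]] := GU _ (block_mx1_unitary r Su).
exists psi; have psi1' : hsdot psi psi = 1.
  by rewrite /hsdot (_ : _ *m _ = 1%:M) ?mxtrace1.
split=> //.
have AA : (prog_run G psi)^t* *m prog_run G psi = 1%:M.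
  by rewrite prog_run_gram // psi1'.
have VV : (col_mx S 0)^t* *m col_mx S (0 : 'M[C]_(r, k)) = 1%:M.
  by rewrite col_mx0_gram; apply: mulmx1C; apply/unitarymxP.
have := residual_fidelity k0 AA VV.
rewrite -tens_id_max_entangled -trace_normE => fid.
have tn : trace_norm (tens_id (programmed_map G psi
    \- unitary_map (block_mx S 0 0 1%:M))%R (max_entangled k r)) <= eps.
  rewrite -lee_fin; apply: le_trans dia; apply: ereal_sup_ubound.
  by exists k, (max_entangled k r); split=> //; exact: max_entangled_state.
move: fid; set f := hsdot _ _ => fid.
have {}fid : 2 * (1 - f) <= eps%:C by apply: le_trans fid _; rewrite lecR.
rewrite lerBlDr addrC -lerBlDr rmorphM fmorphV rmorph_nat ler_pdivlMr ?ltr0n //.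
by rewrite mulrC.
Qed.

End Quantum.

(** * Sums over the grid *)

Section GridSum.
Variables (R : realFieldType) (n : nat).

(** The absolute difference: natural subtraction truncates, so at most one summand is nonzero. *)
Definition ord_dist (a b : 'I_n) : nat := (a - b) + (b - a).

Lemma ord_dist_eq0 (a b : 'I_n) : (ord_dist a b == 0%N) = (a == b).
Proof. by rewrite addn_eq0 -eqn_leq. Qed.

Lemma card_ord_ball (a : 'I_n) (K : nat) :
  (#|[pred b | (ord_dist a b <= K)%N]| <= (2 * K).+1)%N.
Proof.
(* On the ball [b + K - a] is not truncated and is at most [2 K], so [f] is injective there. *)
pose f (b : 'I_n) : 'I_(2 * K).+1 := inord (b + K - a).
rewrite -[leqRHS]card_ord.
rewrite -(card_in_imset (f := f)) ?max_card // => b c.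
rewrite !inE /ord_dist => ab ac /(congr1 val) /=.
rewrite !inordK; [|lia..] => e; apply: val_inj => /=; lia.
Qed.

(** The weight [1 / a ^ 2] on the cone where [a] is a largest coordinate; three such cones cover all
    nonzero points. *)
Definition axis_term (a b c : nat) : R :=
  if [&& (0 < a)%N, (b <= a)%N & (c <= a)%N] then (a%:R ^+ 2)^-1 else 0.

Lemma axis_term_ge0 a b c : 0 <= axis_term a b c.
Proof. by rewrite /axis_term; case: ifP => // _; rewrite invr_ge0 sqr_ge0. Qed.

Lemma inv_norm_le_axis_terms (a b c : nat) :
  (0 < a + b + c)%N ->
  (a%:R ^+ 2 + b%:R ^+ 2 + c%:R ^+ 2)^-1
    <= axis_term a b c + axis_term b a c + axis_term c a b :> R.
Proof.
have aux (x y z : nat) : (0 < x)%N -> (y <= x)%N -> (z <= x)%N ->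
    (x%:R ^+ 2 + y%:R ^+ 2 + z%:R ^+ 2)^-1 <= axis_term x y z :> R.
  move=> x0 yx zx; rewrite /axis_term x0 yx zx /=.
  rewrite lef_pV2 ?posrE ?ltr_wpDr ?addr_ge0 ?sqr_ge0 ?exprn_gt0 ?ltr0n //.
  by rewrite -addrA lerDl addr_ge0 ?sqr_ge0.
move=> pos.
have nonneg := (axis_term_ge0 a b c, axis_term_ge0 b a c, axis_term_ge0 c a b).
have : [|| (b <= a) && (c <= a), (a <= b) && (c <= b) | (a <= c) && (b <= c)]%N.
  lia.
case/or3P => /andP[h1 h2].
- apply: (le_trans (aux a b c _ h1 h2)); first lia.
  by rewrite -addrA lerDl addr_ge0 ?nonneg.
- rewrite [X in X + _]addrC.
  apply: (le_trans (aux b a c _ h1 h2)); first lia.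
  by rewrite addrAC lerDr addr_ge0 ?nonneg.
- rewrite [X in X^-1](_ : _ = c%:R ^+ 2 + a%:R ^+ 2 + b%:R ^+ 2); last by ring.
  apply: (le_trans (aux c a b _ h1 h2)); first lia.
  by rewrite lerDr addr_ge0 ?nonneg.
Qed.

(** A slice at distance [K > 0] meets the cone in at most [(2 K + 1) ^ 2 <= 9 K ^ 2] points of
    weight [1 / K ^ 2], so each [x] contributes at most 9. *)
Lemma axis_sum (a b c : 'I_n) :
  \sum_x \sum_y \sum_z axis_term (ord_dist a x) (ord_dist b y) (ord_dist c z)
    <= 9 * n%:R.
Proof.
rewrite mulr_natr -[n in leRHS]card_ord -sumr_const; apply: ler_sum => x _.
set K := ord_dist a x.
have [K0|K0] := posnP K.
  rewrite big1 // => y _; rewrite big1 // => z _.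
  by rewrite /axis_term K0.
pose ball (e f : 'I_n) : R := (ord_dist e f <= K)%N%:R.
have -> : \sum_y \sum_z axis_term K (ord_dist b y) (ord_dist c z)
    = (K%:R ^+ 2)^-1 * (\sum_y ball b y) * (\sum_z ball c z).
  rewrite -mulrA mulr_suml mulr_sumr; apply: eq_bigr => y _.
  rewrite !mulr_sumr; apply: eq_bigr => z _.
  rewrite /axis_term K0 /ball; case: leqP => _; case: leqP => _ /=;
    by rewrite ?mulr1n ?mulr0n ?mulr1 ?mulr0.
have ballK e : \sum_f ball e f <= 3 * K%:R.
  apply: (@le_trans _ _ (2 * K).+1%:R); last by rewrite -natrM ler_nat; lia.
  rewrite /ball -natr_sum ler_nat; apply: leq_trans (card_ord_ball e K).
  by rewrite -sum1_card [leqRHS]big_mkcond.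
have ball0 e : 0 <= \sum_f ball e f by apply: sumr_ge0 => f _; rewrite ler0n.
rewrite -mulrA ler_pdivrMl ?exprn_gt0 ?ltr0n //.
have -> : K%:R ^+ 2 * 9 = (3 * K%:R) * (3 * K%:R) :> R by ring.
exact: ler_pM.
Qed.

(** In three dimensions the inverse square is summable at its singularity, so the sum is linear in
    [n]: three cones of [9 n] each. *)
Lemma grid_sum (a b c : 'I_n) :
  \sum_x \sum_y \sum_z
    (((ord_dist a x)%:R ^+ 2 + (ord_dist b y)%:R ^+ 2
      + (ord_dist c z)%:R ^+ 2)^-1 : R)
  <= 27 * n%:R.
Proof.
apply: (@le_trans _ _ (\sum_x \sum_y \sum_z
    (axis_term (ord_dist a x) (ord_dist b y) (ord_dist c z)
     + axis_term (ord_dist b y) (ord_dist a x) (ord_dist c z)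
     + axis_term (ord_dist c z) (ord_dist a x) (ord_dist b y)))).
  do 3! [apply: ler_sum => ? _].
  move: (ord_dist a _) (ord_dist b _) (ord_dist c _) => i j k.
  have [/inv_norm_le_axis_terms //|] := ltnP 0 (i + j + k).
  rewrite leqn0 !addn_eq0 => /andP[/andP[/eqP-> /eqP->] /eqP->].
  (* At distance zero both sides vanish, the inverse of 0 being 0. *)
  by rewrite !mulr0n expr0n /= !addr0 invr0.
rewrite [leRHS](_ : _ = 9 * n%:R + 9 * n%:R + 9 * n%:R); last by ring.
do 2 under eq_bigr do under eq_bigr do rewrite big_split.
under eq_bigr do (rewrite big_split /=; rewrite big_split /=).
rewrite !big_split /=; apply: lerD; first apply: lerD.
- exact: axis_sum.
- rewrite exchange_big; exact: axis_sum.
under eq_bigr do rewrite exchange_big /=.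
rewrite exchange_big; exact: axis_sum.
Qed.

End GridSum.

(** * Angles between grid points *)

Section CosineGap.
Variable R : rcfType.

(* Lagrange's identity: (1+|v|^2)(1+|v'|^2) - (1+v.v')^2
   = |v - v'|^2 + |v x v'|^2. *)
Lemma cosine_gap (x y z x' y' z' : R)
    (N := 1 + x ^+ 2 + y ^+ 2 + z ^+ 2)
    (N' := 1 + x' ^+ 2 + y' ^+ 2 + z' ^+ 2) :
  N <= 7 / 4 -> N' <= 7 / 4 ->
  16 / 49 * ((x - x') ^+ 2 + (y - y') ^+ 2 + (z - z') ^+ 2)
    <= 1 - ((1 + x * x' + y * y' + z * z') / (Num.sqrt N * Num.sqrt N')) ^+ 2.
Proof.
move=> hN hN'.
have N1 : 1 <= N by rewrite /N -!addrA lerDl !addr_ge0 ?sqr_ge0.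
have N1' : 1 <= N' by rewrite /N' -!addrA lerDl !addr_ge0 ?sqr_ge0.
have N0 : 0 < N by lra.
have N0' : 0 < N' by lra.
set D := (x - x') ^+ 2 + _ + _.
have D0 : 0 <= D by rewrite /D !addr_ge0 ?sqr_ge0.
rewrite expr_div_n exprMn !sqr_sqrtr ?(ltW N0) ?(ltW N0') //.
have NN : 0 < N * N' by exact: mulr_gt0.
rewrite -[X in X - _](divff (lt0r_neq0 NN)) -mulrBl ler_pdivlMr //.
have gap : D <= N * N' - (1 + x * x' + y * y' + z * z') ^+ 2.
  rewrite -subr_ge0.
  rewrite (_ : _ - _ = (x * y' - y * x') ^+ 2 + (x * z' - z * x') ^+ 2
    + (y * z' - z * y') ^+ 2); last by rewrite /D /N /N'; ring.
  by rewrite !addr_ge0 ?sqr_ge0.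
apply: le_trans gap; rewrite mulrAC.
rewrite -[leRHS]mul1r ler_wpM2r //.
(* The factor [16 / 49] pays for the denominator [N * N']. *)
have : N * N' <= (7 / 4) * (7 / 4) by apply: ler_pM; lra.
lra.
Qed.

(** Three such squares give [N <= 7 / 4] in [cosine_gap]. *)
Lemma grid_coord_sqr n (i : 'I_n) : (i%:R / n%:R - 1 / 2 : R) ^+ 2 <= 1 / 4.
Proof.
have n0 : 0 < n%:R :> R by rewrite ltr0n (leq_trans _ (ltn_ord i)).
have i0 : 0 <= i%:R / n%:R :> R by rewrite divr_ge0.
have i1 : i%:R / n%:R <= 1 :> R by rewrite ler_pdivrMr // mul1r ler_nat ltnW.
nra.
Qed.

Lemma grid_coord_dist n (i j : 'I_n) :
  (i%:R / n%:R - 1 / 2 - (j%:R / n%:R - 1 / 2) : R) ^+ 2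
    = (ord_dist i j)%:R ^+ 2 / n%:R ^+ 2.
Proof.
have -> : i%:R / n%:R - 1 / 2 - (j%:R / n%:R - 1 / 2)
    = (i%:R - j%:R) / n%:R :> R by ring.
rewrite expr_div_n; congr (_ / _); rewrite /ord_dist.
have [ij|/ltnW ji] := leqP i j.
  by rewrite (eqP ij) add0n natrB // -sqrrN opprB.
by rewrite (eqP (ji : (j - i == 0)%N)) addn0 natrB.
Qed.

End CosineGap.

(** * Quaternions and Weyl operators *)

Section Family.
Variable C : numClosedFieldType.

(** [X ^ n - 1] splits with distinct roots, and [n] distinct [n]-th roots of unity include a
    primitive one. *)
Lemma prim_root_exists n : (0 < n)%N -> exists z : C, n.-primitive_root z.
Proof.
move=> n0; have [s Ds] := closed_field_poly_normal ('X^n - 1 : {poly C}).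
rewrite (monicP _) ?monicXnsubC // scale1r in Ds.
have rn1 : all n.-unity_root s by apply/allP=> z; rewrite -root_prod_XsubC -Ds.
have sz_s : (n < (size s).+1)%N.
  by rewrite -(size_prod_XsubC s id) -Ds size_XnsubC.
have [|z] := hasP (cyclic.has_prim_root n0 rn1 _ sz_s); last by exists z.
rewrite -separable.separable_prod_XsubC -Ds.
by rewrite cyclotomic.separable_Xn_sub_1 // pnatr_eq0 -lt0n.
Qed.

(** A diagonal of powers of [z] followed by a cyclic shift: addition in ['I_m.+1] is modulo
    [m + 1]. *)
Definition weyl (m : nat) (z : C) (ab : 'I_m.+1 * 'I_m.+1) : 'M[C]_m.+1 :=
  \matrix_(i, j) ((i == j + ab.1)%:R * z ^+ (ab.2 * j)).

Lemma prim_root_conj n (z : C) : n.-primitive_root z -> z^* * z = 1.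
Proof.
move=> zn; have n0 := prim_order_gt0 zn.
have /eqP : `|z| ^+ n = 1 by rewrite -normrX prim_expr_order // normr1.
by rewrite mulrC -normCK pexpr_eq1 // => /eqP->; rewrite expr1n.
Qed.

Lemma weyl_unitary m z (ab : 'I_m.+1 * 'I_m.+1) :
  m.+1.-primitive_root z -> weyl z ab \is unitarymx.
Proof.
move=> zm; apply/unitarymxP/mulmx1C/matrixP => j l; rewrite !mxE.
rewrite (bigD1 (j + ab.1)) //= big1 => [|i /negPf ij]; last first.
  by rewrite !mxE ij mul0r conjC0 mul0r.
rewrite !mxE eqxx mul1r addr0 (inj_eq (addIr _)).
have [->|] := eqVneq j l; last by rewrite mul0r mulr0.
by rewrite mul1r rmorphXn -exprMn (prim_root_conj zm) expr1n.
Qed.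

(** Different shifts have disjoint supports; equal shifts leave a geometric sum in a root of unity
    [x], which vanishes unless [x = 1]. *)
Lemma weyl_orthogonal m z (ab cd : 'I_m.+1 * 'I_m.+1) :
  m.+1.-primitive_root z ->
  hsdot (weyl z ab) (weyl z cd) = m.+1%:R * (ab == cd)%:R.
Proof.
move=> zm; case: ab cd => [a b] [c d]; rewrite hsdotE exchange_big /=.
pose x := z^* ^+ b * z ^+ d.
transitivity (\sum_(j < m.+1) (a == c)%:R * x ^+ j).
  apply: eq_bigr => j _.
  rewrite (bigD1 (j + a)) //= big1 => [|i /negPf ij]; last first.
    by rewrite !mxE /= ij mul0r conjC0 mul0r.
  rewrite !mxE /= eqxx mul1r addr0 (inj_eq (addrI _)) mulrCA; congr (_ * _).
  by rewrite rmorphXn /= exprMn -!exprM.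
rewrite -mulr_sumr xpair_eqE.
have [_|] := eqVneq a c; last by rewrite mul0r mulr0.
rewrite mul1r /=.
have zz := prim_root_conj zm.
have zb e : z^* ^+ e * z ^+ e = 1 by rewrite -exprMn zz expr1n.
have [bd|bd] := eqVneq b d.
  rewrite mulr1 (eq_bigr (fun=> 1)) ?sumr_const ?card_ord // => j _.
  by rewrite /x bd zb expr1n.
rewrite mulr0; have xm : x ^+ m.+1 = 1.
  rewrite exprMn -!exprM !(mulnC _ m.+1) !exprM (prim_expr_order zm) expr1n.
  rewrite mulr1.
  by rewrite -rmorphXn /= (prim_expr_order zm) conjC1 expr1n.
have x1 : x - 1 != 0.
  rewrite subr_eq0; apply: contra bd => /eqP xe.
  have : z ^+ b == z ^+ d.
    rewrite -[z ^+ d]mul1r -(zb b) (mulrC (z^* ^+ b)) -mulrA -/x xe mulr1 //.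
  by rewrite (eq_prim_root_expr zm) !modn_small.
apply: (mulfI x1); rewrite mulr0 -subrX1 xm subrr //.
Qed.

Definition quat (a b c e : C) : 'M[C]_2 :=
  \matrix_(i, j)
    if i == 0 then (if j == 0 then a + 'i * b else c + 'i * e)
    else (if j == 0 then - c + 'i * e else a - 'i * b).

(** [A] represents the conjugate of one quaternion times the other: its real part is [w], and its
    imaginary part is anti-Hermitian and traceless. *)
Lemma quat_gram (a b c e a' b' c' e' : C)
    (w := a * a' + b * b' + c * c' + e * e')
    (A := (quat a b c e)^t* *m quat a' b' c' e') :
  a^* = a -> b^* = b -> c^* = c -> e^* = e ->
  a'^* = a' -> b'^* = b' -> c'^* = c' -> e'^* = e' ->
  A + A^t* = (2 * w)%:M /\ \tr A = 2 * w.
Proof.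
move=> ra rb rc re ra' rb' rc' re'; have i2 := sqrCi C.
have entries : [/\ A 0 0 = w + 'i * (a * b' - b * a' - c * e' + e * c'),
   A 0 1 = (a * c' - c * a' + b * e' - e * b')
           + 'i * (a * e' - e * a' + c * b' - b * c'),
   A 1 0 = - (a * c' - c * a' + b * e' - e * b')
           + 'i * (a * e' - e * a' + c * b' - b * c')
   & A 1 1 = w - 'i * (a * b' - b * a' - c * e' + e * c')].
  rewrite /A /w; split; rewrite !mxE !big_ord_recl big_ord0 !mxE /=
    ?(rmorphD, rmorphB, rmorphN, rmorphM) /= ?conjCi ?ra ?rb ?rc ?re; ring: i2.
have conjE := (rmorphD, rmorphB, rmorphN, rmorphM).
case: entries => e00 e01 e10 e11; clearbody A; split; last first.
  by rewrite /mxtrace !big_ord_recl big_ord0 (_ : lift _ _ = 1) ?e00 ?e11;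
    [ring | exact: val_inj].
have two (P : 'I_2 -> Prop) : P 0 -> P 1 -> forall i, P i.
  move=> P0 P1 [[|[|//]] lt].
    by rewrite (_ : Ordinal lt = 0) //; exact: val_inj.
  by rewrite (_ : Ordinal lt = 1) //; exact: val_inj.
apply/matrixP; elim/two; elim/two; rewrite !mxE ?e00 ?e01 ?e10 ?e11 /w /=
  ?conjE /= ?conjE /= ?conjE /= ?conjCi ?ra ?rb ?rc ?re ?ra' ?rb' ?rc' ?re';
  ring: i2.
Qed.

Lemma quat_unitary a b c e :
  a^* = a -> b^* = b -> c^* = c -> e^* = e ->
  a ^+ 2 + b ^+ 2 + c ^+ 2 + e ^+ 2 = 1 -> quat a b c e \is unitarymx.
Proof.
move=> ra rb rc re n1; apply/unitarymxP/mulmx1C.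
have [] := quat_gram ra rb rc re ra rb rc re.
rewrite -!expr2 n1 mulr1 adjmxM trmxCK => h _.
apply: (@scalerI _ _ (2 : C)); first by rewrite pnatr_eq0.
by rewrite scale_scalar_mx mulr1 -h scaler_nat mulr2n.
Qed.

Lemma adjmx_tens m n p q (A : 'M[C]_(m, n)) (B : 'M[C]_(p, q)) :
  (tensmx A B)^t* = tensmx (A^t*) (B^t*).
Proof. by apply/matrixP => i j; rewrite !mxE rmorphM. Qed.

Lemma tens_scalar_mxM m n (a b : C) :
  tensmx (a%:M : 'M[C]_m) (b%:M : 'M[C]_n) = (a * b)%:M.
Proof.
apply/matrixP => i j.
case: (mxtens_indexP i) => i1 i2; case: (mxtens_indexP j) => j1 j2.
rewrite tensmxE !mxE (can_eq (@mxtens_indexK _ _)) xpair_eqE.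
case: (i1 == j1); case: (i2 == j2);
  by rewrite ?mulr1n ?mulr0n ?mulr0 ?mul0r.
Qed.

Lemma tens_unitary m n (A : 'M[C]_m) (B : 'M[C]_n) :
  A \is unitarymx -> B \is unitarymx -> tensmx A B \is unitarymx.
Proof.
move=> /unitarymxP AA /unitarymxP BB; apply/unitarymxP.
by rewrite adjmx_tens tensmx_mul AA BB tens_scalar_mxM mulr1.
Qed.

Lemma mxtrace_tens m n (A : 'M[C]_m) (B : 'M[C]_n) :
  \tr (tensmx A B) = \tr A * \tr B.
Proof.
rewrite /mxtrace sum_mxtens mulr_suml; apply: eq_bigr => i _.
by rewrite mulr_sumr; apply: eq_bigr => j _; rewrite tensmxE.
Qed.

Lemma tens_gram m n (A A' : 'M[C]_m) (B B' : 'M[C]_n) :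
  (tensmx A B)^t* *m tensmx A' B' = tensmx (A^t* *m A') (B^t* *m B').
Proof. by rewrite adjmx_tens tensmx_mul. Qed.

Lemma hsdot_tens m n (A A' : 'M[C]_m) (B B' : 'M[C]_n) :
  hsdot (tensmx A B) (tensmx A' B') = hsdot A A' * hsdot B B'.
Proof. by rewrite /hsdot tens_gram mxtrace_tens. Qed.

(** The equal second factors cancel, so the Hermitian part of [W] stays scalar, as
    [residual_overlap] requires. *)
Lemma tens_gram_real m n (A A' : 'M[C]_m) (B : 'M[C]_n) (w : C)
    (W := (tensmx A B)^t* *m tensmx A' B) :
  B \is unitarymx ->
  A^t* *m A' + (A^t* *m A')^t* = (2 * w)%:M -> W + W^t* = (2 * w)%:M.
Proof.
move=> /unitarymxP/mulmx1C BB Aw; rewrite /W tens_gram BB adjmx_tens.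
rewrite trmx1 map_mx1 -[in RHS](mulr1 (2 * w)) -tens_scalar_mxM -Aw.
by apply/matrixP => i j; rewrite !mxE mulrDl.
Qed.

End Family.

(** * Unitaries indexed by the grid *)

Section Core.
Variable R : realType.
Local Notation C := R[i].

Definition grid_coord n (i : 'I_n) : R := i%:R / n%:R - 1 / 2.

Definition grid_normsq n (x : 'I_n * 'I_n * 'I_n) : R :=
  1 + grid_coord x.1.1 ^+ 2 + grid_coord x.1.2 ^+ 2 + grid_coord x.2 ^+ 2.

Definition grid_cos n (x y : 'I_n * 'I_n * 'I_n) : R :=
  (1 + grid_coord x.1.1 * grid_coord y.1.1 + grid_coord x.1.2 * grid_coord y.1.2
     + grid_coord x.2 * grid_coord y.2)
  / (Num.sqrt (grid_normsq x) * Num.sqrt (grid_normsq y)).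

(** The squared distance, in units of the grid step [1 / n]. *)
Definition grid_dist n (x y : 'I_n * 'I_n * 'I_n) : R :=
  (ord_dist x.1.1 y.1.1)%:R ^+ 2 + (ord_dist x.1.2 y.1.2)%:R ^+ 2
  + (ord_dist x.2 y.2)%:R ^+ 2.

(* The normalization of the quaternion 1 + v, for v a point of the grid
   {i/n - 1/2}^3. *)
Definition grid_quat n (x : 'I_n * 'I_n * 'I_n) : 'M[C]_2 :=
  let s := (Num.sqrt (grid_normsq x))^-1 in
  quat s%:C (s * grid_coord x.1.1)%:C (s * grid_coord x.1.2)%:C
       (s * grid_coord x.2)%:C.

Lemma grid_normsq_bounds n (x : 'I_n * 'I_n * 'I_n) :
  1 <= grid_normsq x <= 7 / 4.
Proof.
have := grid_coord_sqr R x.1.1; have := grid_coord_sqr R x.1.2.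
have := grid_coord_sqr R x.2; rewrite -!/(grid_coord _) /grid_normsq.
have := sqr_ge0 (grid_coord x.1.1); have := sqr_ge0 (grid_coord x.1.2).
have := sqr_ge0 (grid_coord x.2); lra.
Qed.

Lemma grid_cos_gap n (x y : 'I_n * 'I_n * 'I_n) :
  16 / 49 * (grid_dist x y / n%:R ^+ 2) <= 1 - grid_cos x y ^+ 2.
Proof.
rewrite /grid_dist [X in _ * X]mulrDl [X in _ * (X + _)]mulrDl.
rewrite -!grid_coord_dist.
have /andP[_ hx] := grid_normsq_bounds x.
have /andP[_ hy] := grid_normsq_bounds y.
exact: (cosine_gap hx hy).
Qed.

Lemma realC_conj (a : R) : ((a%:C : C)^*)%R = a%:C.
Proof. by rewrite conj_Creal //; apply/complex_realP; exists a. Qed.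

Lemma grid_quat_unitary n (x : 'I_n * 'I_n * 'I_n) : grid_quat x \is unitarymx.
Proof.
have /andP[N1 _] := grid_normsq_bounds x.
apply: quat_unitary; rewrite ?realC_conj // -!rmorphXn -!rmorphD /=.
congr (_%:C); rewrite !exprMn -[X in X + _ + _ + _]mulr1 -!mulrDr.
rewrite exprVn sqr_sqrtr ?mulVf //; last by apply: le_trans N1.
by rewrite gt_eqF // (lt_le_trans _ N1).
Qed.

Lemma grid_quat_gram n (x y : 'I_n * 'I_n * 'I_n)
    (A := (grid_quat x)^t* *m grid_quat y) :
  A + A^t* = (2 * (grid_cos x y)%:C)%:M /\ \tr A = 2 * (grid_cos x y)%:C.
Proof.
have [] := quat_gram (realC_conj (Num.sqrt (grid_normsq x))^-1)
  (realC_conj ((Num.sqrt (grid_normsq x))^-1 * grid_coord x.1.1))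
  (realC_conj ((Num.sqrt (grid_normsq x))^-1 * grid_coord x.1.2))
  (realC_conj ((Num.sqrt (grid_normsq x))^-1 * grid_coord x.2))
  (realC_conj (Num.sqrt (grid_normsq y))^-1)
  (realC_conj ((Num.sqrt (grid_normsq y))^-1 * grid_coord y.1.1))
  (realC_conj ((Num.sqrt (grid_normsq y))^-1 * grid_coord y.1.2))
  (realC_conj ((Num.sqrt (grid_normsq y))^-1 * grid_coord y.2)).
rewrite -!rmorphM -!rmorphD /= => h1 h2.
have -> : grid_cos x y
   = (Num.sqrt (grid_normsq x))^-1 * (Num.sqrt (grid_normsq y))^-1 +
   (Num.sqrt (grid_normsq x))^-1 * grid_coord x.1.1 *
   ((Num.sqrt (grid_normsq y))^-1 * grid_coord y.1.1) +
   (Num.sqrt (grid_normsq x))^-1 * grid_coord x.1.2 *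
   ((Num.sqrt (grid_normsq y))^-1 * grid_coord y.1.2) +
   (Num.sqrt (grid_normsq x))^-1 * grid_coord x.2 *
   ((Num.sqrt (grid_normsq y))^-1 * grid_coord y.2).
  rewrite /grid_cos invfM; ring.
by split.
Qed.

End Core.

(** * Dimension of the program register *)

(** The hypothesis means [t <= 1 / 64], so [t ^ 2 * (2 + t) ^ 2] is barely above
    [4 * t ^ 2 = 2 * eps]. *)
Lemma overlap_const_le (R : realType) (eps : R) (t := Num.sqrt (eps / 2)) :
  0 < eps -> 32 * (64 * eps) <= 1 -> (2 * t + t ^+ 2) ^+ 2 <= 51 / 25 * eps.
Proof.
move=> e0 e1; have t0 : 0 <= t by exact: sqrtr_ge0.
have t2 : t ^+ 2 = eps / 2 by rewrite sqr_sqrtr // divr_ge0 // ltW.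
clearbody t.
have t64 : t <= 1 / 64.
  rewrite -(@ler_pXn2r _ 2) ?nnegrE ?divr_ge0 // t2; lra.
have -> : (2 * t + t ^+ 2) ^+ 2 = t ^+ 2 * (2 + t) ^+ 2 by ring.
have t3 : (2 + t) ^+ 2 <= 102 / 25 by nra.
rewrite t2; apply: (@le_trans _ _ (eps / 2 * (102 / 25))); last lra.
by rewrite ler_wpM2l // divr_ge0 // ltW.
Qed.

Lemma one_sub_half_ge0 (R : realFieldType) (eps : R) :
  32 * (64 * eps) <= 1 -> 0 <= 1 - eps / 2.
Proof. lra. Qed.

(** Only points with the Weyl label of [i] count: the diagonal gives 1 and [grid_sum] the rest. *)
Lemma grid_weight_sum (R : realType) (n : nat) (Q : finType) (kappa : R)
    (i : ('I_n * 'I_n * 'I_n) * Q) :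
  0 <= kappa ->
  \sum_(j : ('I_n * 'I_n * 'I_n) * Q) (i.2 == j.2)%:R * ((i.1 == j.1)%:R
      + kappa * n%:R ^+ 2 * (grid_dist R i.1 j.1)^-1)
    <= 1 + 27 * kappa * n%:R ^+ 3.
Proof.
move=> kappa0.
rewrite -(pair_bigA _ (fun (x : 'I_n * 'I_n * 'I_n) (q : Q) =>
  (i.2 == q)%:R * ((i.1 == x)%:R
     + kappa * n%:R ^+ 2 * (grid_dist R i.1 x)^-1))) /=.
rewrite (eq_bigr (fun x => (i.1 == x)%:R
  + kappa * n%:R ^+ 2 * (grid_dist R i.1 x)^-1)); last first.
  move=> x _; rewrite (bigD1 i.2) //= eqxx mul1r big1 ?addr0 // => q.
  by rewrite eq_sym => /negPf->; rewrite mul0r.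
rewrite big_split /=; apply: lerD.
  rewrite (bigD1 i.1) //= eqxx big1 ?addr0 // => x.
  by rewrite eq_sym => /negPf->.
rewrite -mulr_sumr.
have -> : 27 * kappa * n%:R ^+ 3 = kappa * n%:R ^+ 2 * (27 * n%:R) by ring.
apply: ler_wpM2l; first by rewrite mulr_ge0 ?sqr_ge0.
rewrite -(pair_bigA _ (fun (ab : 'I_n * 'I_n) (c : 'I_n) =>
  (grid_dist R i.1 (ab, c))^-1)) /=.
rewrite -(pair_bigA _ (fun a b : 'I_n =>
  \sum_c (grid_dist R i.1 ((a, b), c))^-1)) /=.
exact: grid_sum.
Qed.

(** * Pairwise overlaps within the family *)

Section Dimension.
Variables (R : realType) (m r p : nat) (eps : R).
Local Notation C := R[i].
Local Notation k := (2 * m.+1)%N.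
Variable G : 'M[C]_((k + r) * p).
Hypotheses (eps_gt0 : 0 < eps) (eps_le : 32 * (64 * eps) <= 1).
Hypothesis G_univ : universal_processor eps G.

Let t : R := Num.sqrt (eps / 2).
Let tau2 : R := (2 * t + t ^+ 2) ^+ 2.

Let t_ge0 : 0 <= t. Proof. exact: sqrtr_ge0. Qed.
Let t_sqr : t ^+ 2 = eps / 2.
Proof. by rewrite sqr_sqrtr // divr_ge0 // ltW. Qed.

Let k_gt0 : (0 < k)%N. Proof. by []. Qed.

Variables (n : nat) (z : C).
Hypothesis zm : m.+1.-primitive_root z.
Local Notation T := (('I_n * 'I_n * 'I_n) * ('I_m.+1 * 'I_m.+1))%type.

Let S (i : T) : 'M[C]_k := tensmx (grid_quat R i.1) (weyl z i.2).

Let S_unitary i : S i \is unitarymx.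
Proof.
by apply: tens_unitary; [exact: grid_quat_unitary | exact: weyl_unitary].
Qed.

Let S_hsdot i j :
  hsdot (S i) (S j) = (2 * grid_cos R i.1 j.1 * m.+1%:R * (i.2 == j.2)%:R)%:C.
Proof.
rewrite hsdot_tens weyl_orthogonal // /hsdot.
by rewrite (grid_quat_gram R i.1 j.1).2 !rmorphM !rmorph_nat /= mulrA.
Qed.

Variable psi : T -> 'cV[C]_p.
Let A i := prog_run G (psi i).
Let V i : 'M[C]_(k + r, k) := col_mx (S i) 0.
Let u i := residual_vec (A i) (V i).
Let D i := prod_run (V i) (u i).

Hypothesis psi1 : forall i, hsdot (psi i) (psi i) = 1.
Hypothesis fid : forall i, 1 - (eps / 2)%:C <= hsdot (u i) (u i).

Let AA i : (A i)^t* *m A i = 1%:M.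
Proof. by rewrite prog_run_gram ?psi1 //; case: G_univ. Qed.

Let VV i j : (V i)^t* *m V j = (S i)^t* *m S j.
Proof. exact: col_mx0_gram. Qed.

Let VV1 i : (V i)^t* *m V i = 1%:M.
Proof. by rewrite VV; apply: mulmx1C; exact/unitarymxP. Qed.

Let kR : (0 : C) < k%:R. Proof. by rewrite ltr0n. Qed.

Let u_le1 i : hsdot (u i) (u i) <= 1.
Proof.
have := hsdot_ge0 (A i - D i); rewrite (residual_error k_gt0) //.
by rewrite pmulr_rge0 // subr_ge0.
Qed.

Let D_hsdot i j : hsdot (D i) (D j) = hsdot (u i) (u j) * hsdot (S i) (S j).
Proof. by rewrite {1}/hsdot prod_run_gram mxtraceZ VV. Qed.

Let D_le i : hsdot (D i) (D i) <= k%:R.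
Proof.
rewrite D_hsdot -[leRHS]mul1r ler_pM ?hsdot_ge0 //.
by rewrite /hsdot -VV VV1 mxtrace1.
Qed.

Let B_le i : hsdot (A i - D i) (A i - D i) <= k%:R * (t%:C) ^+ 2.
Proof.
rewrite (residual_error k_gt0) // ler_pM2l // -rmorphXn /= t_sqr.
by rewrite lerBlDr addrC -lerBlDr; exact: fid.
Qed.

Let overlap i j : i.2 = j.2 -> grid_cos R i.1 j.1 ^+ 2 < 1 ->
  `|hsdot (u i) (u j)| ^+ 2 * (1 - grid_cos R i.1 j.1 ^+ 2)%:C <= tau2%:C.
Proof.
move=> ij w1.
have WW : ((S i)^t* *m S j)^t* *m ((S i)^t* *m S j) = 1%:M.
  apply: mulmx1C; rewrite adjmxM trmxCK -mulmxA (mulmxA (S j)).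
  have /unitarymxP -> := S_unitary j; rewrite mul1mx.
  by apply: mulmx1C; exact/unitarymxP.
have A12 : (A i)^t* *m A j = (hsdot (psi i) (psi j))%:M.
  by rewrite prog_run_gram //; case: G_univ.
have D12 : (D i)^t* *m D j = hsdot (u i) (u j) *: ((S i)^t* *m S j).
  by rewrite prod_run_gram VV.
have Wre : (S i)^t* *m S j + ((S i)^t* *m S j)^t*
    = (2 * (grid_cos R i.1 j.1)%:C)%:M.
  rewrite /S ij; apply: tens_gram_real; first exact: weyl_unitary.
  exact: (grid_quat_gram R i.1 j.1).1.
have trW : \tr ((S i)^t* *m S j) = (grid_cos R i.1 j.1)%:C * k%:R.
  rewrite -/(hsdot _ _) S_hsdot ij eqxx -(rmorph_nat (real_complex R)) -rmorphM.
by congr (_%:C); rewrite natrM mulr1n; ring.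
have w1C : (grid_cos R i.1 j.1)%:C ^+ 2 < 1 :> C by rewrite -rmorphXn /= ltcR.
have := residual_overlap k_gt0 _ (realC_conj _) w1C A12 D12 WW Wre trW
  (D_le i) (D_le j) (B_le i) (B_le j).
rewrite lecR t_ge0 => /(_ isT); rewrite rmorphB rmorphXn /=.
by rewrite /tau2 !(rmorphXn, rmorphD, rmorphM, rmorph_nat).
Qed.

(** Different Weyl labels give 0 and equal indices the trivial bound [k ^ 2]. Otherwise [overlap]
    divided by [grid_cos_gap] bounds the residual overlap, and the factor [c ^ 2 <= 1] is
    dropped. *)
Let term_bound i j :
  `|hsdot (D i) (D j)| ^+ 2
    <= (4 * m.+1%:R ^+ 2 * (i.2 == j.2)%:R
        * ((i.1 == j.1)%:R
           + 49 / 16 * tau2 * n%:R ^+ 2 * (grid_dist R i.1 j.1)^-1))%:C.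
Proof.
have [H HE] : exists H : R, `|hsdot (u i) (u j)| ^+ 2 = H%:C.
  by apply/complex_realP; rewrite realX // normr_real.
have H0 : 0 <= H by rewrite -lecR -HE exprn_ge0.
have H1 : H <= 1.
  rewrite -lecR -HE; apply: le_trans (hsdot_cauchy_schwarz _ _) _.
  by rewrite -[leRHS]mulr1 ler_pM ?hsdot_ge0 ?u_le1.
rewrite D_hsdot normrM exprMn HE S_hsdot.
have [ij|_] := eqVneq i.2 j.2; last first.
  by rewrite !mulr0n !mulr0 mul0r rmorph0 normr0 expr0n mulr0.
set c := grid_cos _ _ _; set D2 := grid_dist _ _ _.
rewrite real_normK; last by apply/complex_realP; eexists.
rewrite -rmorphXn -rmorphM lecR /= !mulr1n !mulr1.
have -> : H * (2 * c * m.+1%:R) ^+ 2 = 4 * m.+1%:R ^+ 2 * (H * c ^+ 2) by ring.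
rewrite ler_pM2l ?mulr_gt0 ?exprn_gt0 ?ltr0n //.
have gap : 16 / 49 * (D2 / n%:R ^+ 2) <= 1 - c ^+ 2 := grid_cos_gap R i.1 j.1.
have D20 : 0 <= D2 by rewrite !addr_ge0 ?sqr_ge0.
have n2 : 0 < n%:R ^+ 2 :> R.
  by rewrite exprn_gt0 // ltr0n (leq_trans _ (ltn_ord i.1.1.1)).
have c1 : c ^+ 2 <= 1.
  rewrite -subr_ge0; apply: le_trans gap.
  by rewrite !mulr_ge0 ?invr_ge0 // ltW.
have Hc : H * c ^+ 2 <= H by rewrite -[leRHS]mulr1 ler_wpM2l.
have [xy|xy] := eqVneq i.1 j.1.
  apply: le_trans Hc (le_trans H1 _); rewrite mulr1n lerDl.
  have tau20 : 0 <= tau2 by exact: sqr_ge0.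
  by rewrite divr_ge0 // mulr_ge0 ?(ltW n2) // mulr_ge0.
apply: le_trans Hc _; rewrite mulr0n add0r.
have D2pos : 0 < D2.
  rewrite lt_neqAle D20 andbT eq_sym; apply: contra xy => D2z.
  move: D2z; rewrite /D2 /grid_dist !paddr_eq0 ?addr_ge0 ?sqr_ge0 // !sqrf_eq0.
  rewrite !pnatr_eq0 -!andbA => /and3P[d1 d2 d3].
  case: (i.1) (j.1) d1 d2 d3 => [[a b] e] [[a' b'] e'] /= d1 d2 d3.
  by rewrite !ord_dist_eq0 in d1 d2 d3; rewrite !xpair_eqE d1 d2 d3.
have gap0 : 0 < 1 - c ^+ 2.
  by apply: lt_le_trans gap; rewrite mulr_gt0 // divr_gt0.
have Ht : H * (1 - c ^+ 2) <= tau2.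
  rewrite -lecR rmorphM /= -HE; apply: overlap => //.
  by rewrite -subr_gt0.
have : H * (16 / 49 * (D2 / n%:R ^+ 2)) <= tau2.
  by apply: le_trans Ht; rewrite ler_wpM2l.
rewrite -ler_pdivlMr; last by rewrite mulr_gt0 // divr_gt0.
move=> /le_trans; apply; rewrite le_eqVlt; apply/orP; left; apply/eqP.
have n0 : n%:R != 0 :> R.
  by apply: contraTneq n2 => ->; rewrite expr0n ltxx.
by field; rewrite n0 lt0r_neq0.
Qed.

Hypothesis n_gt0 : (0 < n)%N.

Lemma grid_dimension_bound :
  n%:R ^+ 3 * m.+1%:R ^+ 2 * (1 - eps / 2) ^+ 4
    <= p%:R * (1 + 27 * (49 / 16 * tau2) * n%:R ^+ 3).
Proof.
have EE a b : hsdot (prog_slice G a) (prog_slice G b) = k%:R *+ (a == b).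
  rewrite /hsdot prog_slice_orthonormal; last by case: G_univ.
  by rewrite mxtrace_scalar; case: (a == b); rewrite ?mul0rn.
have psi1' i : \sum_b `|psi i b 0| ^+ 2 = 1.
  by rewrite -(psi1 i) hsdot_sqr; apply: eq_bigr => b _; rewrite big_ord1.
have f0 := one_sub_half_ge0 eps_le.
have AD i : k%:R * (1 - eps / 2)%:C
    <= `|hsdot (\sum_b psi i b 0 *: prog_slice G b) (D i)|.
  rewrite (run_residual (A i) (V i) k_gt0) normrM.
  rewrite !ger0_norm ?hsdot_ge0 ?ler0n //.
  by rewrite ler_pM2l // rmorphB; exact: fid.
have f0C : 0 <= (1 - eps / 2)%:C :> C by rewrite lecR.
have := program_dimension_bound k_gt0 f0C EE psi1' AD.
rewrite !card_prod !card_ord; set X := 1 + _ * _ ^+ 3.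
have tau20 : 0 <= 49 / 16 * tau2 by rewrite mulr_ge0 // sqr_ge0.
have row i : \sum_j `|hsdot (D i) (D j)| ^+ 2 <= (4 * m.+1%:R ^+ 2 * X)%:C.
  apply: (@le_trans _ _ (\sum_(j : T) (4 * m.+1%:R ^+ 2 * ((i.2 == j.2)%:R
      * ((i.1 == j.1)%:R + 49 / 16 * tau2 * n%:R ^+ 2
                           * (grid_dist R i.1 j.1)^-1)))%:C)).
    by apply: ler_sum => j _; rewrite [4 * _ * (_ * _)]mulrA; exact: term_bound.
  rewrite -rmorph_sum lecR -mulr_sumr ler_wpM2l ?mulr_ge0 ?sqr_ge0 //.
  exact: grid_weight_sum.
have total : \sum_i \sum_j `|hsdot (D i) (D j)| ^+ 2
    <= ((n * n * n * (m.+1 * m.+1))%:R * (4 * m.+1%:R ^+ 2 * X))%:C.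
  apply: (@le_trans _ _ (\sum_(i : T) (4 * m.+1%:R ^+ 2 * X)%:C)).
    by apply: ler_sum => i _; exact: row.
  rewrite sumr_const -[leLHS]mulr_natl !card_prod !card_ord.
  by rewrite -[X in X * _](rmorph_nat (real_complex R)) -rmorphM.
move=> dim; have {dim} := le_trans dim (ler_wpM2l (ler0n _ p) total).
rewrite -!(rmorph_nat (real_complex R)) -!rmorphXn -!rmorphM lecR /= !natrM.
move=> dim.
have M0 : 0 < m.+1%:R :> R by rewrite ltr0n.
have n0 : 0 < n%:R :> R by rewrite ltr0n.
(* The common factor: family size [n ^ 3 * m.+1 ^ 2] times [k ^ 2]. *)
have c0 : 0 < n%:R ^+ 3 * m.+1%:R ^+ 4 * 4 :> R.
  by rewrite !mulr_gt0 ?exprn_gt0.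
rewrite -(ler_pM2l c0); move: dim; congr (_ <= _); ring.
Qed.

End Dimension.

Lemma dimension_arith (R : realFieldType) (eps M2 p y tau2 : R) :
  0 < eps -> 32 * (64 * eps) <= 1 -> 0 <= M2 -> 0 <= p -> 0 < y ->
  1 <= y * eps -> tau2 <= 51 / 25 * eps ->
  y * M2 * (1 - eps / 2) ^+ 4 <= p * (1 + 27 * (49 / 16 * tau2) * y) ->
  M2 <= p * (256 * eps).
Proof.
move=> e0 e1 M0 p0 y0 ye tau dim.
have h4 : 170 / 256 <= (1 - eps / 2) ^+ 4.
  have h : 15 / 16 <= 1 - eps / 2 by lra.
  have h2 : 225 / 256 <= (1 - eps / 2) ^+ 2 by nra.
  rewrite (exprM _ 2 2); nra.
(* [27 * 49 / 16 * 51 / 25 < 169], and [1 <= y * eps] absorbs the remaining 1. The same 170 in [h4]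
   then cancels. *)
have up : 1 + 27 * (49 / 16 * tau2) * y <= 170 * (y * eps) by nra.
have chain : y * (M2 * (170 / 256)) <= y * (p * (170 * eps)).
  apply: (@le_trans _ _ (y * M2 * (1 - eps / 2) ^+ 4)).
    by rewrite -mulrA ler_pM2l // ler_wpM2l.
  apply: le_trans dim _.
  have -> : y * (p * (170 * eps)) = p * (170 * (y * eps)) by ring.
  by rewrite ler_wpM2l.
rewrite ler_pM2l // in chain; lra.
Qed.

Lemma processor_dimension (R : realType) (m r p : nat) (eps : R)
    (G : 'M[R[i]]_((2 * m.+1 + r) * p)) :
  0 < eps -> 32 * (64 * eps) <= 1 -> universal_processor eps G ->
  m.+1%:R ^+ 2 <= p%:R * (256 * eps).
Proof.
move=> e0 e1 Gu.
have [z zm] := prim_root_exists R[i] (ltn0Sn m).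
(* The grid is fine enough for [n ^ 3 * eps >= 1], so the diagonal terms are absorbed. *)
pose n := (Num.bound eps^-1).+1.
pose S (i : ('I_n * 'I_n * 'I_n) * ('I_m.+1 * 'I_m.+1)) : 'M[R[i]]_(2 * m.+1) :=
  tensmx (grid_quat R i.1) (weyl z i.2).
have Su i : S i \is unitarymx.
  by apply: tens_unitary; [exact: grid_quat_unitary | exact: weyl_unitary].
have [psi hpsi] := choice (fun i => processor_residual (ltn0Sn _) Gu (Su i)).
have := grid_dimension_bound e0 e1 Gu zm (fun i => (hpsi i).1)
  (fun i => (hpsi i).2) (ltn0Sn _).
set tau2 := (_ + _) ^+ 2 => dim.
have tau : tau2 <= 51 / 25 * eps := overlap_const_le e0 e1.
have n_eps : 1 <= n%:R * eps.
  rewrite -ler_pdivrMr // div1r ltW //.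
  have := archi_boundP (ltW (_ : 0 < eps^-1)); rewrite invr_gt0 => /(_ e0).
  by move=> /lt_le_trans; apply; rewrite ler_nat leqnSn.
have n1 : 1 <= n%:R :> R by rewrite ler1n.
have n3 : n%:R <= n%:R ^+ 3 :> R by rewrite ler_eXnr.
apply: dimension_arith dim => //; rewrite ?sqr_ge0 ?exprn_gt0 ?ltr0n //.
by apply: le_trans n_eps _; rewrite ler_pM2r.
Qed.

(** * Constants *)

Section Constants.
Variable R : realType.
Implicit Types (eps : R) (d : nat).

Lemma delta1_ge eps : 0 < eps -> 2 * Num.sqrt (2 * eps) <= delta1 eps.
Proof.
move=> e0; rewrite /delta1 ler_pM2l // -!addrA lerDl.
have := mulr_ge0 (mulr_ge0 (ler0n R 2) (sqrtr_ge0 2)) (powR_ge0 eps (3 / 2)).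
have := sqr_ge0 eps; lra.
Qed.

Lemma delta2_ge0 eps : 0 < eps -> 0 <= delta2 eps.
Proof. by move=> e0; rewrite addr_ge0 ?sqr_ge0 // mulr_ge0 // ltW. Qed.

(** With [s ^ 2 = 2 * eps] and [delta1 >= 2 * s], the right-hand sides are at least [(8 * s) ^ 2]
    and [(16 * s) ^ 2]. *)
Lemma delta_bounds eps : 0 < eps ->
  128 * eps <= (4 * delta1 eps + delta2 eps) ^+ 2 /\
  512 * eps <= delta4 eps ^+ 2.
Proof.
move=> e0; have := delta1_ge e0; have := delta2_ge0 e0; rewrite /delta4.
have : Num.sqrt (2 * eps) ^+ 2 = 2 * eps.
  by rewrite sqr_sqrtr // mulr_ge0 // ltW.
have := sqrtr_ge0 (2 * eps).
move: (Num.sqrt _) (delta1 _) (delta2 _) => s d1 d2 s0 s2 d20 d1s.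
have h1 : (8 * s) ^+ 2 <= (4 * d1 + d2) ^+ 2.
  by rewrite ler_pXn2r ?nnegrE //; lra.
have h2 : (16 * s) ^+ 2 <= (8 * d1 + d2) ^+ 2.
  by rewrite ler_pXn2r ?nnegrE //; lra.
rewrite !exprMn s2 in h1 h2; split; [move: h1 | move: h2]; lra.
Qed.

Lemma eps_small eps : 0 < eps -> 8 * delta1 eps + delta2 eps < 1 / 2 ->
  32 * (64 * eps) <= 1.
Proof.
move=> e0; have := delta1_ge e0; have := delta2_ge0 e0.
have : Num.sqrt (2 * eps) ^+ 2 = 2 * eps.
  by rewrite sqr_sqrtr // mulr_ge0 // ltW.
have := sqrtr_ge0 (2 * eps).
move: (Num.sqrt _) (delta1 _) (delta2 _) => s d1 d2 s0 s2 d20 d1s h.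
have : s <= 1 / 32 by lra.
nra.
Qed.

Lemma expR1_ge2 : 2 <= expR 1 :> R.
Proof. by have := expR_ge1Dx (1 : R); rewrite -[1 + 1]/(2%:R). Qed.

Lemma pide_bounds d : (0 < d)%N -> 0 < pide R d <= 2 * d%:R.
Proof.
move=> d0; have dR : 0 < d%:R :> R by rewrite ltr0n.
have e0 := expR_gt0 (1 : R).
have p0 := pi_gt0 R; rewrite /pide divr_gt0 ?mulr_gt0 //=.
rewrite ler_pdivrMr //; have := pihalf_lt2 R; have := expR1_ge2 => e2 p4.
have : pi * d%:R <= 4 * d%:R :> R by rewrite ler_pM2r //; lra.
have : d%:R * 2 <= d%:R * expR 1 :> R by rewrite ler_pM2l.
lra.
Qed.

Lemma ln2_ge : 1 / 2 <= ln 2 :> R.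
Proof.
have := @le_ln1Dx R (- (1 / 2)) _.
rewrite (_ : 1 - 1 / 2 = 2^-1); last by field.
rewrite lnV ?posrE //; lra.
Qed.

Lemma log2_ge1 (x : R) : 2 <= x -> 1 <= log2 x.
Proof.
move=> x2; have l2 := ln2_ge; rewrite /log2 ler_pdivlMr ?mul1r; last by lra.
by rewrite ler_ln ?posrE //; lra.
Qed.

(** [ln x <= x], [pide <= 2 * d] and [ln 2 >= 1 / 2] bound the logarithm by [4 * d]. *)
Lemma rate_numerator_le d : (0 < d)%N ->
  d%:R * log2 (pide R d) + d%:R ^+ 2 - 1 <= 5 * d%:R ^+ 2.
Proof.
move=> d0; have /andP[K0 K2] := pide_bounds d0.
have dR : 0 < d%:R :> R by rewrite ltr0n.
have l2 := ln2_ge; have lK := ltW (ln_sublinear K0).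
have : log2 (pide R d) <= 4 * d%:R.
  rewrite /log2 ler_pdivrMr; last by lra.
  nra.
nra.
Qed.

End Constants.

(** * Deduction of the two bounds *)

Lemma processor_program_gt0 (R : realType) d p (eps : R)
    (G : 'M[R[i]]_(d * p)) :
  universal_processor eps G -> (0 < p)%N.
Proof.
case=> _ /(_ 1%:M); case=> [|psi [+ _]].
  by apply/unitarymxP; rewrite trmx1 map_mx1 mulmx1.
case: p psi G => // psi _ /matrixP/(_ 0 0).
by rewrite !mxE big_ord0 => /esym/eqP; rewrite oner_eq0.
Qed.

(** At most one level is left over, so [d <= 3 * m.+1], whence the factor 9. *)
Lemma processor_dimension_le (R : realType) d p (eps : R)
    (G : 'M[R[i]]_(d * p)) :
  (1 < d)%N -> 0 < eps -> 32 * (64 * eps) <= 1 -> universal_processor eps G ->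
  1 <= p%:R * (256 * eps) /\ d%:R ^+ 2 <= 9 * (p%:R * (256 * eps)).
Proof.
move=> d1 e0 e1.
have [m [r [r1 dE]]] : exists m r : nat, (r <= 1)%N /\ d = (2 * m.+1 + r)%N.
  exists (d./2.-1), (odd d : nat); split; first by case: odd.
  by rewrite prednK ?half_gt0 // mul2n addnC odd_double_half.
subst d => Gu; have dim := processor_dimension e0 e1 Gu.
split; first by apply: le_trans dim; rewrite -natrX ler1n.
apply: (@le_trans _ _ (9 * m.+1%:R ^+ 2)); last by rewrite ler_wpM2l.
rewrite -!natrX -natrM ler_nat -[9%N]/(3 ^ 2)%N -expnMn leq_sqr.
by rewrite [X in (_ <= X)%N]mulSn addnC leq_add2r (leq_trans r1).
Qed.

Local Open Scope ring_scope.
Local Open Scope complex_scope.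

Theorem theorem4p52 (R : realType) :
  (forall (d p : nat) (eps : R) (G : 'M[R[i]]_(d * p)),
    (0 < d)%N -> 0 < eps ->
    8 * delta1 eps + delta2 eps < 1 / 2 ->
    universal_processor eps G ->
    p%:R >= 1 / (2 * (4 * delta1 eps + delta2 eps) ^+ 2)
            * Num.min 1 ((pide R d ^+ d * (4 * delta1 eps + delta2 eps) ^+ 2)
                           `^ (2 / (d%:R ^+ 2 + 1)))) /\
  (exists eta : R, 0 < eta /\
    forall (d p : nat) (eps : R) (G : 'M[R[i]]_(d * p)),
    (0 < d)%N -> 0 < eps ->
    8 * delta1 eps + delta2 eps < 1 / 2 ->
    universal_processor eps G ->
    8 * delta1 eps + delta2 eps >
      (pide R d ^- d * 2 `^ (- d%:R ^+ 2 + 1)) `^ eta ->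
    p%:R >= eta * ((d%:R * log2 (pide R d) + d%:R ^+ 2 - 1)
                   / (2 * delta4 eps ^+ 2 * log2 (1 / delta4 eps)))).
Proof.
split=> [d p eps G d0 e0 small Gu|].
  have e1 := eps_small e0 small; have [a2 _] := delta_bounds e0.
  move: a2; set a := 4 * delta1 eps + delta2 eps => a2.
  have a0 : 0 < a ^+ 2 by apply: lt_le_trans a2; rewrite mulr_gt0.
  have c0 : 0 <= 1 / (2 * a ^+ 2).
    by apply: divr_ge0 => //; apply: mulr_ge0 => //; exact: ltW.
  (* For [d = 1] the exponent is 1, and the second entry of the minimum reduces the bound to
     [pide R 1 / 2 <= 1]. *)
  have [d1|d1] := leqP d 1.
    have -> : d = 1%N by apply/eqP; rewrite eqn_leq d1.
    have /andP[K0 K2] := pide_bounds R (ltn0Sn 0).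
    rewrite !expr1 expr1n -[1 + 1]/(2%:R) divff // powRr1; last first.
      by rewrite mulr_ge0 // ltW.
    apply: (@le_trans _ _ 1); last by rewrite ler1n (processor_program_gt0 Gu).
    apply: (@le_trans _ _ (1 / (2 * a ^+ 2) * (pide R 1 * a ^+ 2))).
      apply: ler_wpM2l; first exact: c0.
      by rewrite ge_min lexx orbT.
    have -> : 1 / (2 * a ^+ 2) * (pide R 1 * a ^+ 2) = pide R 1 / 2.
      by field; rewrite (contraTneq _ a0) // => ->; rewrite expr0n ltxx.
    by rewrite ler_pdivrMr // mul1r (le_trans K2) // mulr1.
  have [p1 _] := processor_dimension_le d1 e0 e1 Gu.
  apply: (@le_trans _ _ (1 / (2 * a ^+ 2))).
    rewrite -[leRHS]mulr1; apply: ler_wpM2l; last by rewrite ge_min lexx.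
    exact: c0.
  have a20 : 0 < 2 * a ^+ 2 by apply: mulr_gt0.
  rewrite ler_pdivrMr //; apply: (le_trans p1).
  by rewrite ler_wpM2l //; lra.
(* For [d >= 2] the numerator is at most [5 * d ^ 2 <= 45 * q] with [q = 256 * p * eps], and [eta]
   times it must not exceed [4 * q]; [d = 1] uses [eta <= 1]. *)
exists (1 / 100); split=> // d p eps G d0 e0 small Gu big.
have e1 := eps_small e0 small; have [_ d4] := delta_bounds e0.
rewrite -/(delta4 eps) in small big.
have d4pos : 0 < delta4 eps.
  rewrite /delta4; have := delta1_ge e0; have := delta2_ge0 e0.
  have : 0 < Num.sqrt (2 * eps) by rewrite sqrtr_gt0 mulr_gt0.
  lra.
have [d1|d1] := leqP d 1.
  have dE : d = 1%N by apply/eqP; rewrite eqn_leq d1.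
  move: big; rewrite dE expr1 expr1n addNr powRr0 mulr1 => big.
  have /andP[K0 K2] := pide_bounds R (ltn0Sn 0).
  (* This makes [delta4 > 1 / 2], against the smallness assumption. *)
  suff : 1 / 2 <= ((pide R 1)^-1) `^ (1 / 100) by lra.
  apply: (@le_trans _ _ ((1 / 2) `^ (1 / 100))).
    rewrite -[leLHS]powRr1 //; apply: ger_powR; lra.
  apply: ge0_ler_powR; rewrite ?nnegrE ?invr_ge0 ?(ltW K0) //.
  rewrite div1r lef_pV2 ?posrE //; lra.
have [_ pd] := processor_dimension_le d1 e0 e1 Gu.
have num := rate_numerator_le R d0.
have L1 : 1 <= log2 (1 / delta4 eps).
  by apply: log2_ge1; rewrite ler_pdivlMr //; lra.
move: num L1; set X := _ + _ - 1; set L := log2 _ => num L1.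
(* [delta4 ^ 2 >= 512 * eps], and [L >= 1] because [delta4 < 1 / 2]. *)
have den : 4 * (256 * eps) <= 2 * delta4 eps ^+ 2 * L by nra.
have den0 : 0 < 2 * delta4 eps ^+ 2 * L.
  by rewrite mulr_gt0 ?(lt_le_trans _ L1) // mulr_gt0 // exprn_gt0.
rewrite mulrA ler_pdivrMr //.
apply: (@le_trans _ _ (p%:R * (4 * (256 * eps)))); last by rewrite ler_wpM2l.
have q0 : 0 <= p%:R * (256 * eps) by rewrite !mulr_ge0 ?ler0n ?(ltW e0).
rewrite mulrCA; move: (p%:R * _) pd q0 => q pd q0; lra.
Qed.
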